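(* Let $T>0$, $\mathbf X\in\mathcal D^\alpha([0,T],V)$ and $\mathbf Z=(Z,Z')\in\mathcal C^\alpha_{\mathbf X}([0,T],U)$, and let $\mathcal Z=(Z,\mathbb Z)$ be the canonical lift of $\mathbf Z$. Assume $F\in C_b^2(W,\mathcal L(U,W))$ and $F_0\in C_b^1(W,W)$. Then $(Y,Y')\in\mathcal C^\alpha_{\mathbf X}([0,T],W)$ with $Y'=F(Y)Z'$ is a solution of the controlled rough differential equation $$dY_t=F(Y_t)\,d\mathbf Z_t+F_0(Y_t)\,dt$$ if and only if $(Y,F(Y))\in\mathcal C^\alpha_{\mathcal Z}([0,T],W)$ is a solution of the rough differential equation $$dY_t=F(Y_t)\,d\mathcal Z_t+F_0(Y_t)\,dt .$$
   Context: $U,V,W$ are finite-dimensional Banach spaces, $\mathcal L(A,B)$ denotes bounded linear maps, $\alpha\in(1/3,1/2]$, and $X_{s,t}:=X_t-X_s$. $C_b^k(A,B)$ is the space of $k$-times continuously differentiable maps $A\to B$ with bounded derivatives up to order $k$. Rough paths: $\mathcal D^\alpha([0,T],V)$ is the set of pairs $\mathbf X=(X,\mathbb X)$, $X:[0,T]\to V$ $\alpha$-Hölder, $\mathbb X:\{0\le s\le t\le T\}\to V\otimes V$ with $\sup\|\mathbb X_{s,t}\|/|t-s|^{2\alpha}<\infty$, satisfying Chen's relation $\mathbb X_{s,t}=\mathbb X_{s,u}+\mathbb X_{u,t}+X_{s,u}\otimes X_{u,t}$ for $s\le u\le t$. Controlled paths: $\mathcal C^\alpha_{\mathbf X}([0,T],W)$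 is the set of pairs $(Y,Y')$, $Y:[0,T]\to W$, $Y':[0,T]\to\mathcal L(V,W)$, with $Y'$ $\alpha$-Hölder and $R^Y_{s,t}:=Y_{s,t}-Y'_sX_{s,t}$ satisfying $\sup_{s<t}\|R^Y_{s,t}\|/|t-s|^{2\alpha}<\infty$. Integral: for $(Y,Y')\in\mathcal C^\alpha_{\mathbf X}([0,T],\mathcal L(U,W))$ and $(Z,Z')\in\mathcal C^\alpha_{\mathbf X}([0,T],U)$, $$\int_s^tY_r\,d\mathbf Z_r:=\lim_{|\mathcal P|\to0}\sum_{[u,v]\in\mathcal P}\bigl(Y_uZ_{u,v}+Y'_uZ'_u\mathbb X_{u,v}\bigr),$$ the limit being over partitions $\mathcal P$ of $[s,t]$. The path $F(Y)$ is controlled by $\mathbf X$ with Gubinelli derivative $DF(Y)Y'$. Canonical lift: $\mathcal Z=(Z,\mathbb Z)\in\mathcal D^\alpha([0,T],U)$ with $\mathbb Z_{s,t}:=\int_s^tZ_{s,r}\otimes dZ_r=\lim_{|\mathcal P|\to0}\sum_{[u,v]\in\mathcal P}\bigl(Z_{s,u}\otimes Z_{u,v}+(Z'_u\otimes Z'_u)\mathbb X_{u,v}\bigr)$. Solution of the first equation: $(Y,Y')\in\mathcal C^\alpha_{\mathbf X}([0,T],W)$ with $Y_t=Y_0+\int_0^tF(Y_r)\,d\mathbf Z_r+\int_0^tF_0(Y_r)\,dr$ and $Y'_t=F(Y_t)Z'_t$ for all $t\in[0,T]$. Solution of the second equation: $(Y,F(Y))\in\mathcal C^\alpha_{\mathcal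 Z}([0,T],W)$ with $Y_t=Y_0+\int_0^tF(Y_r)\,d\mathcal Z_r+\int_0^tF_0(Y_r)\,dr$ for all $t\in[0,T]$, where $\int_0^tF(Y_r)\,d\mathcal Z_r=\lim\sum_{[u,v]}\bigl(F(Y_u)Z_{u,v}+DF(Y_u)F(Y_u)\mathbb Z_{u,v}\bigr)$. *)

(* Defs.v *)
From Stdlib Require Import Reals Lra List FunctionalExtensionality ProofIrrelevance.
From Coquelicot Require Import Coquelicot.

Set Implicit Arguments.
Unset Strict Implicit.
Unset Printing Implicit Defensive.

Open Scope R_scope.

Definition finite_dim (V : NormedModule R_AbsRing) : Prop :=
  exists (n : nat) (e : nat -> V), forall x : V,
    exists c : nat -> R, x = sum_n (fun i => scal (c i) (e i)) n.

(* Coquelicot's [is_linear] includes boundedness. *)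
Record lin_map (A B : NormedModule R_AbsRing) : Type := MkLin {
  lin_fun :> A -> B;
  lin_is_linear : is_linear lin_fun
}.

Section OperatorNorm.

Context {A B : NormedModule R_AbsRing}.
Implicit Types f g h : lin_map A B.

Lemma lin_ext f g : (forall x, f x = g x) -> f = g.
Proof.
destruct f as [f Hf], g as [g Hg]; simpl; intros E.
assert (f = g) by (apply functional_extensionality; exact E); subst g.
now rewrite (proof_irrelevance _ Hf Hg).
Qed.

Lemma lin_plus_is_linear f g : is_linear (fun x => plus (f x) (g x)).
Proof.
apply (is_linear_comp (fun x => (f x, g x)) (fun p : B * B => plus (fst p) (snd p))).
- apply is_linear_prod; apply lin_is_linear.
- apply is_linear_plus.
Qed.

Lemma lin_opp_is_linear f : is_linear (fun x => opp (f x)).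
Proof. apply (is_linear_comp f opp); [apply lin_is_linear | apply is_linear_opp]. Qed.

Lemma lin_scal_is_linear (k : R_AbsRing) f : is_linear (fun x => scal k (f x)).
Proof.
apply (is_linear_comp f (fun y : B => scal (k : R_AbsRing) y)).
- apply lin_is_linear.
- apply (is_linear_scal_r (K := R_AbsRing)); intros; apply Rmult_comm.
Qed.

Definition lin_zero : lin_map A B := MkLin (@is_linear_zero _ A B).
Definition lin_plus f g : lin_map A B := MkLin (lin_plus_is_linear f g).
Definition lin_opp f : lin_map A B := MkLin (lin_opp_is_linear f).
Definition lin_scal (k : R_AbsRing) f : lin_map A B := MkLin (lin_scal_is_linear k f).

Lemma lin_plus_comm f g : lin_plus f g = lin_plus g f.
Proof. apply lin_ext; intros; apply plus_comm. Qed.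
Lemma lin_plus_assoc f g h : lin_plus f (lin_plus g h) = lin_plus (lin_plus f g) h.
Proof. apply lin_ext; intros; apply plus_assoc. Qed.
Lemma lin_plus_zero_r f : lin_plus f lin_zero = f.
Proof. apply lin_ext; intros; apply plus_zero_r. Qed.
Lemma lin_plus_opp_r f : lin_plus f (lin_opp f) = lin_zero.
Proof. apply lin_ext; intros x; exact (plus_opp_r (f x)). Qed.

Definition lin_AbelianMonoid_mixin :=
  AbelianMonoid.Mixin (lin_map A B) lin_plus lin_zero
    lin_plus_comm lin_plus_assoc lin_plus_zero_r.
Canonical lin_AbelianMonoid :=
  AbelianMonoid.Pack (lin_map A B) lin_AbelianMonoid_mixin (lin_map A B).
Definition lin_AbelianGroup_mixin :=
  AbelianGroup.Mixin lin_AbelianMonoid lin_opp lin_plus_opp_r.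
Canonical lin_AbelianGroup :=
  AbelianGroup.Pack (lin_map A B)
    (AbelianGroup.Class _ lin_AbelianMonoid_mixin lin_AbelianGroup_mixin) (lin_map A B).

Lemma lin_scal_assoc (x y : R_AbsRing) f :
  lin_scal x (lin_scal y f) = lin_scal (mult x y) f.
Proof. apply lin_ext; intros z; exact (scal_assoc x y (f z)). Qed.
Lemma lin_scal_one f : lin_scal (@one R_AbsRing) f = f.
Proof. apply lin_ext; intros z; exact (scal_one (f z)). Qed.
Lemma lin_scal_distr_l (x : R_AbsRing) f g :
  lin_scal x (plus f g) = plus (lin_scal x f) (lin_scal x g).
Proof. apply lin_ext; intros z; exact (scal_distr_l x (f z) (g z)). Qed.
Lemma lin_scal_distr_r (x y : R_AbsRing) f :
  lin_scal (plus x y) f = plus (lin_scal x f) (lin_scal y f).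
Proof. apply lin_ext; intros z; exact (scal_distr_r x y (f z)). Qed.

Definition lin_ModuleSpace_mixin :=
  ModuleSpace.Mixin R_AbsRing lin_AbelianGroup lin_scal
    lin_scal_assoc lin_scal_one lin_scal_distr_l lin_scal_distr_r.
Definition lin_ModuleSpace_class :=
  ModuleSpace.Class R_AbsRing (lin_map A B) _ lin_ModuleSpace_mixin.
Canonical lin_ModuleSpace :=
  ModuleSpace.Pack R_AbsRing (lin_map A B) lin_ModuleSpace_class (lin_map A B).

Definition op_norm f : R :=
  real (Lub_Rbar (fun r => exists x : A, norm x <= 1 /\ r = norm (f x))).

Lemma op_norm_lub f :
  is_lub_Rbar (fun r => exists x : A, norm x <= 1 /\ r = norm (f x)) (op_norm f).
Proof.
unfold op_norm.
destruct (linear_norm _ (lin_is_linear f)) as [M [HM Hf]].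
pose proof (Lub_Rbar_correct
  (fun r => exists x : A, norm x <= 1 /\ r = norm (f x))) as H.
destruct (Lub_Rbar _) as [l | |]; simpl; auto; exfalso; destruct H as [H1 H2].
- apply (H2 M); intros r [x [Hx ->]]; simpl.
  apply Rle_trans with (1 := Hf x); nra.
- apply (H1 (norm (f zero))); exists zero; split; [rewrite norm_zero; lra | reflexivity].
Qed.

Lemma op_norm_ge0 f : 0 <= op_norm f.
Proof.
destruct (op_norm_lub f) as [H _].
apply Rle_trans with (norm (f zero)); [apply norm_ge_0 |].
apply (H (norm (f zero))); exists zero; split; [rewrite norm_zero; lra | reflexivity].
Qed.

Lemma op_norm_spec f x : norm (f x) <= op_norm f * norm x.
Proof.
destruct (Req_dec (norm x) 0) as [H0 | H0].
- rewrite (norm_eq_zero _ H0), (linear_zero _ (lin_is_linear f)), !norm_zero; lra.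
- assert (Hp : 0 < norm x) by (pose proof (norm_ge_0 x); lra).
  assert (Hi : 0 < / norm x) by (apply Rinv_0_lt_compat; lra).
  assert (H : norm (f (scal (/ norm x : R_AbsRing) x)) <= op_norm f).
  { destruct (op_norm_lub f) as [H _]; apply (H (norm _)); eexists; split; [| reflexivity].
    apply Rle_trans with (1 := norm_scal _ _); unfold abs; simpl.
    rewrite Rabs_right by lra; right; field; lra. }
  replace (f x) with (scal (norm x : R_AbsRing) (f (scal (/ norm x : R_AbsRing) x))).
  + apply Rle_trans with (1 := norm_scal _ _); unfold abs; simpl.
    rewrite Rabs_right by lra; nra.
  + rewrite (linear_scal _ (lin_is_linear f)), scal_assoc.
    replace (mult (norm x : R_AbsRing) (/ norm x)) with (@one R_AbsRing).
    * apply (scal_one (K := R_AbsRing)).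
    * unfold mult, one; simpl; field; lra.
Qed.

Lemma op_norm_le f C : 0 <= C -> (forall x, norm (f x) <= C * norm x) -> op_norm f <= C.
Proof.
intros HC H; destruct (op_norm_lub f) as [_ Hl].
apply (Hl C); intros r [x [Hx ->]]; simpl.
apply Rle_trans with (1 := H x); nra.
Qed.

Lemma op_norm_triangle f g : op_norm (plus f g) <= op_norm f + op_norm g.
Proof.
apply op_norm_le.
- pose proof (op_norm_ge0 f); pose proof (op_norm_ge0 g); lra.
- intros x; apply Rle_trans with (1 := norm_triangle (f x) (g x)).
  pose proof (op_norm_spec f x); pose proof (op_norm_spec g x); lra.
Qed.

Lemma op_norm_scal (k : R_AbsRing) f : op_norm (scal k f) <= abs k * op_norm f.
Proof.
apply op_norm_le.
- apply Rmult_le_pos; [apply abs_ge_0 | apply op_norm_ge0].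
- intros x; apply Rle_trans with (1 := norm_scal k (f x)).
  rewrite Rmult_assoc; apply Rmult_le_compat_l; [apply abs_ge_0 | apply op_norm_spec].
Qed.

Lemma op_norm_eq0 f : op_norm f = 0 -> f = zero.
Proof.
intros H; apply lin_ext; intros x; apply norm_eq_zero.
pose proof (op_norm_spec f x); pose proof (norm_ge_0 (f x)); rewrite H in *; lra.
Qed.

Lemma op_norm_opp f : op_norm (opp f) <= op_norm f.
Proof.
apply op_norm_le; [apply op_norm_ge0 |].
intros x; change (norm (opp (f x)) <= op_norm f * norm x).
rewrite norm_opp; apply op_norm_spec.
Qed.

Definition lin_ball f (e : R) g : Prop := op_norm (minus g f) < e.

Lemma lin_ball_center f (e : posreal) : lin_ball f e f.
Proof.
unfold lin_ball; rewrite minus_eq_zero.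
apply Rle_lt_trans with 0; [| apply cond_pos].
apply op_norm_le; [lra |]; intros x; simpl.
change (norm (@zero B) <= 0 * norm x); rewrite norm_zero; lra.
Qed.

Lemma lin_ball_sym f g e : lin_ball f e g -> lin_ball g e f.
Proof.
unfold lin_ball; intros H; apply Rle_lt_trans with (2 := H).
rewrite <- (opp_minus g f); apply op_norm_opp.
Qed.

Lemma lin_ball_triangle f g h e1 e2 :
  lin_ball f e1 g -> lin_ball g e2 h -> lin_ball f (e1 + e2) h.
Proof.
unfold lin_ball; intros H1 H2.
rewrite (minus_trans g h f).
apply Rle_lt_trans with (1 := op_norm_triangle _ _); lra.
Qed.

Definition lin_UniformSpace_mixin :=
  UniformSpace.Mixin (lin_map A B) lin_zero lin_ball
    lin_ball_center lin_ball_sym lin_ball_triangle.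
Canonical lin_UniformSpace :=
  UniformSpace.Pack (lin_map A B) lin_UniformSpace_mixin (lin_map A B).
Definition lin_NormedModuleAux_class :=
  NormedModuleAux.Class R_AbsRing (lin_map A B) lin_ModuleSpace_class lin_UniformSpace_mixin.
Canonical lin_NormedModuleAux :=
  NormedModuleAux.Pack R_AbsRing (lin_map A B) lin_NormedModuleAux_class (lin_map A B).

Lemma lin_norm_ball1 f g e : op_norm (minus g f) < e -> ball f e g.
Proof. exact (fun H => H). Qed.
Lemma lin_norm_ball2 f g (e : posreal) : ball f e g -> op_norm (minus g f) < 1 * e.
Proof. rewrite Rmult_1_l; exact (fun H => H). Qed.

Definition lin_NormedModule_mixin :=
  NormedModule.Mixin R_AbsRing lin_NormedModuleAux op_norm 1
    op_norm_triangle op_norm_scal lin_norm_ball1 lin_norm_ball2 op_norm_eq0.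
Canonical lin_NormedModule :=
  NormedModule.Pack R_AbsRing (lin_map A B)
    (NormedModule.Class _ _ lin_NormedModuleAux_class lin_NormedModule_mixin) (lin_map A B).

End OperatorNorm.

Arguments lin_NormedModule A B : clear implicits.
Notation Lin A B := (lin_NormedModule A B).

Definition lin_comp {A B C : NormedModule R_AbsRing} (g : Lin B C) (f : Lin A B) : Lin A C :=
  MkLin (is_linear_comp _ _ (lin_is_linear f) (lin_is_linear g)).

Lemma bilin_precomp_is_linear {A B C D : NormedModule R_AbsRing}
  (p : Lin A (Lin B D)) (q : Lin C B) : is_linear (fun a : A => lin_comp (p a) q).
Proof.
split.
- intros x y; apply lin_ext; intros c; simpl.
  now rewrite (linear_plus _ (lin_is_linear p)).
- intros k x; apply lin_ext; intros c; simpl.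
  now rewrite (linear_scal _ (lin_is_linear p)).
- assert (Hp := op_norm_ge0 p); assert (Hq := op_norm_ge0 q).
  assert (Hpq := Rmult_le_pos _ _ Hp Hq).
  exists (op_norm p * op_norm q + 1); split; [lra |].
  intros x; assert (Hx := norm_ge_0 x); apply op_norm_le; [nra |].
  intros c; simpl; apply Rle_trans with (1 := op_norm_spec (p x) (q c)).
  assert (H1 : op_norm (p x) <= op_norm p * norm x) by exact (op_norm_spec p x).
  assert (H2 := op_norm_spec q c); assert (Hc := norm_ge_0 c).
  apply Rle_trans with ((op_norm p * norm x) * (op_norm q * norm c)).
  + apply Rmult_le_compat; auto using norm_ge_0, op_norm_ge0.
  + assert (0 <= norm x * norm c) by (apply Rmult_le_pos; auto); nra.
Qed.

(* The bilinear map [(a, c) |-> p a (q c)]. *)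
Definition bilin_precomp {A B C D : NormedModule R_AbsRing}
  (p : Lin A (Lin B D)) (q : Lin C B) : Lin A (Lin C D) :=
  MkLin (bilin_precomp_is_linear p q).

(* Bounded bilinear maps [A x B -> C] are curried, as elements of
   [Lin A (Lin B C)].  For finite-dimensional [A] and [B] every linear or
   bilinear map is bounded, so an inhabitant is exactly the algebraic tensor
   product endowed with an arbitrary norm (all of them are equivalent). *)
Record tensor_product (A B : NormedModule R_AbsRing) : Type := MkTensor {
  tensor_space :> CompleteNormedModule R_AbsRing;
  tens : Lin A (Lin B tensor_space);
  tens_lift : forall C : NormedModule R_AbsRing, Lin A (Lin B C) -> Lin tensor_space C;
  tens_lift_tens : forall (C : NormedModule R_AbsRing) (b : Lin A (Lin B C)) x y,
    tens_lift b (tens x y) = b x y;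
  tens_lift_unique : forall (C : NormedModule R_AbsRing) (l1 l2 : Lin tensor_space C),
    (forall x y, l1 (tens x y) = l2 (tens x y)) -> l1 = l2
}.
Arguments tens {A B} t.
Arguments tens_lift {A B} t {C} b.

Definition is_frechet_derivative {A B : NormedModule R_AbsRing}
  (f : A -> B) (Df : A -> Lin A B) : Prop :=
  forall x, filterdiff f (locally x) (Df x).

(* The bounds are on the derivatives of orders 1, ..., k; the map itself is not
   required to be bounded. *)
Fixpoint Cb (k : nat) {A B : NormedModule R_AbsRing} (f : A -> B) : Prop :=
  match k with
  | O => forall x, continuous f x
  | S k' => exists Df : A -> Lin A B,
      is_frechet_derivative f Df /\
      (exists M, forall x, norm (Df x) <= M) /\
      Cb k' Df
  end.

(* Paths are total functions on [R]; only their values on [[0, T]] matter, and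
   for two-parameter functions only those at [0 <= s <= t <= T]. *)

Definition incr {V : NormedModule R_AbsRing} (X : R -> V) (s t : R) : V :=
  minus (X t) (X s).

(* Only [s < t] is considered since [Rpower 0 beta = 1]. *)
Definition two_param_bound {V : NormedModule R_AbsRing} (beta T : R) (G : R -> R -> V) : Prop :=
  exists C, forall s t, 0 <= s -> s < t -> t <= T ->
    norm (G s t) <= C * Rpower (t - s) beta.

Definition holder {V : NormedModule R_AbsRing} (alpha T : R) (X : R -> V) : Prop :=
  two_param_bound alpha T (incr X).

Definition rough_path {V : NormedModule R_AbsRing} {VV : tensor_product V V}
  (alpha T : R) (X : R -> V) (XX : R -> R -> VV) : Prop :=
  holder alpha T X /\
  two_param_bound (2 * alpha) T XX /\
  (forall s u t, 0 <= s -> s <= u -> u <= t -> t <= T ->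
    XX s t = plus (plus (XX s u) (XX u t)) (tens VV (incr X s u) (incr X u t))).

Definition controlled {V W : NormedModule R_AbsRing} (alpha T : R) (X : R -> V)
  (Y : R -> W) (Y' : R -> Lin V W) : Prop :=
  holder alpha T Y' /\
  two_param_bound (2 * alpha) T (fun s t => minus (incr Y s t) (Y' s (incr X s t))).

(* A partition [s = t_0 < ... < t_n = t] is the list of its points. *)
Definition is_partition (s t : R) (l : list R) : Prop :=
  hd_error l = Some s /\ last l s = t /\ sorted Rlt l.

Definition partition_filter (s t : R) : (list R -> Prop) -> Prop :=
  within (is_partition s t) (locally_dist seq_step).

Fixpoint partition_sum {W : NormedModule R_AbsRing} (G : R -> R -> W) (l : list R) : W :=
  match l with
  | u :: ((v :: _) as l') => plus (G u v) (partition_sum G l')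
  | _ => zero
  end.

Definition is_partition_lim {W : NormedModule R_AbsRing} (G : R -> R -> W) (s t : R) (I : W) : Prop :=
  filterlim (partition_sum G) (partition_filter s t) (locally I).

Definition is_controlled_int {U V W : NormedModule R_AbsRing} {VV : tensor_product V V}
  (XX : R -> R -> VV) (Y : R -> Lin U W) (Y' : R -> Lin V (Lin U W))
  (Z : R -> U) (Z' : R -> Lin V U) (s t : R) (I : W) : Prop :=
  is_partition_lim
    (fun u v => plus (Y u (incr Z u v)) (tens_lift VV (bilin_precomp (Y' u) (Z' u)) (XX u v)))
    s t I.

Definition is_rough_int {U W : NormedModule R_AbsRing} {UU : tensor_product U U}
  (Z : R -> U) (ZZ : R -> R -> UU) (Y : R -> Lin U W) (Y' : R -> Lin U (Lin U W))
  (s t : R) (I : W) : Prop :=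
  is_partition_lim
    (fun u v => plus (Y u (incr Z u v)) (tens_lift UU (Y' u) (ZZ u v))) s t I.

(* The integral over [[s, t]] of [Z_{s,r}] tensor [dZ_r]; its Gubinelli
   derivative is [Z'_r] followed by [tens].  [iota] selects the limit, as in
   Coquelicot's [RInt]. *)
Definition canonical_lift {U V : NormedModule R_AbsRing} {VV : tensor_product V V}
  (UU : tensor_product U U) (XX : R -> R -> VV) (Z : R -> U) (Z' : R -> Lin V U)
  (s t : R) : UU :=
  iota (is_controlled_int XX (fun r => tens UU (incr Z s r))
          (fun r => lin_comp (tens UU) (Z' r)) Z Z' s t).

Definition controlled_rde_solution {U V W : NormedModule R_AbsRing} {VV : tensor_product V V}
  (alpha T : R) (X : R -> V) (XX : R -> R -> VV) (Z : R -> U) (Z' : R -> Lin V U)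
  (F : W -> Lin U W) (DF : W -> Lin W (Lin U W)) (F0 : W -> W)
  (Y : R -> W) (Y' : R -> Lin V W) : Prop :=
  controlled alpha T X Y Y' /\
  (forall t, 0 <= t <= T ->
    Y' t = lin_comp (F (Y t)) (Z' t) /\
    exists I J : W,
      is_controlled_int XX (fun r => F (Y r)) (fun r => lin_comp (DF (Y r)) (Y' r)) Z Z' 0 t I /\
      is_RInt (fun r => F0 (Y r)) 0 t J /\
      Y t = plus (plus (Y 0) I) J).

Definition rde_solution {U W : NormedModule R_AbsRing} {UU : tensor_product U U}
  (alpha T : R) (Z : R -> U) (ZZ : R -> R -> UU)
  (F : W -> Lin U W) (DF : W -> Lin W (Lin U W)) (F0 : W -> W) (Y : R -> W) : Prop :=
  controlled alpha T Z Y (fun r => F (Y r)) /\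
  (forall t, 0 <= t <= T ->
    exists I J : W,
      is_rough_int Z ZZ (fun r => F (Y r)) (fun r => lin_comp (DF (Y r)) (F (Y r))) 0 t I /\
      is_RInt (fun r => F0 (Y r)) 0 t J /\
      Y t = plus (plus (Y 0) I) J).

(* Main.v *)
Require Import Defs.
From Stdlib Require Import Reals Lra Lia Wf_nat List.
From Coquelicot Require Import Coquelicot.

(** The Riemann sums behind the two rough integrals differ only in their
    second-order terms.  Put B_u = DF(Y_u) F(Y_u).  Since Y' = F(Y) Z', the
    controlled equation contributes B_u applied to (Z'_u (x) Z'_u) XX_{u,v}
    on [u, v], while the equation driven by the lift contributes B_u applied
    to ZZ_{u,v}.  The germ defining ZZ_{u,v}, taken on the single interval
    [u, v], is exactly (Z'_u (x) Z'_u) XX_{u,v}, because its first-order term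
    starts with Z_{u,u} = 0.  The sewing estimate therefore gives
    ZZ_{u,v} = (Z'_u (x) Z'_u) XX_{u,v} + O(|v - u|^(3 alpha))
    ([canonical_lift_expansion]).  As 3 alpha > 1 and B is bounded on [0, T],
    the difference of the two sums tends to 0 with the mesh, so that one limit
    exists if and only if the other does, with the same value
    ([is_partition_lim_close], [controlled_int_iff_rough_int]).  The limits of
    the sums for F(Y) are never constructed: each notion of solution provides
    its own, and only the limit defining ZZ has to be shown to exist.

    That existence, and the error estimate, come from an almost additive germ:
    for some theta > 1 its defect on a split interval of length h is
    O(h^theta).  Cutting a subdivision near the midpoint of its interval gives
    a bound of the same form on its Riemann sum, uniformly in the number of
    points ([partition_sum_bound]); comparing two subdivisions with a common
    refinement then makes the sums Cauchy ([sewing_lim_exists]).  Chen's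
    relation makes the germ of the lift almost additive with
    theta = 3 alpha ([lift_germ_almost_additive]).

    The two requirements of being controlled are equivalent because
    Y_{s,t} - F(Y_s) Z'_s X_{s,t} and Y_{s,t} - F(Y_s) Z_{s,t} differ by F(Y_s)
    applied to the remainder of Z ([controlled_transfer]). *)

Set Implicit Arguments.
Unset Strict Implicit.
Unset Printing Implicit Defensive.

Open Scope R_scope.

(** * Identities in abelian groups *)

Inductive group_expr : Type :=
| EZero
| EAtom (n : nat)
| EOpp (e : group_expr)
| EPlus (e1 e2 : group_expr).

Fixpoint expr_eval {G : AbelianGroup} (env : list G) (e : group_expr) : G :=
  match e with
  | EZero => zero
  | EAtom n => nth n env zero
  | EOpp e => opp (expr_eval env e)
  | EPlus e1 e2 => plus (expr_eval env e1) (expr_eval env e2)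
  end.

Definition signed_eval {G : AbelianGroup} (env : list G) (a : bool * nat) : G :=
  if fst a then nth (snd a) env zero else opp (nth (snd a) env zero).

Fixpoint sum_eval {G : AbelianGroup} (env : list G) (l : list (bool * nat)) : G :=
  match l with
  | nil => zero
  | a :: l => plus (signed_eval env a) (sum_eval env l)
  end.

(** Keeps the list sorted by atom and cancels opposite occurrences, so that two
    expressions that agree in the free abelian group get the same list. *)
Fixpoint sum_insert (a : bool * nat) (l : list (bool * nat)) : list (bool * nat) :=
  match l with
  | nil => a :: nil
  | b :: l' =>
      if Nat.eqb (snd a) (snd b) then
        if Bool.eqb (fst a) (fst b) then a :: l else l'
      else if Nat.ltb (snd a) (snd b) then a :: l else b :: sum_insert a l'
  end.

Fixpoint expr_insert (sign : bool) (e : group_expr) (l : list (bool * nat)) :=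
  match e with
  | EZero => l
  | EAtom n => sum_insert (sign, n) l
  | EOpp e => expr_insert (negb sign) e l
  | EPlus e1 e2 => expr_insert sign e1 (expr_insert sign e2 l)
  end.

Lemma sum_insert_correct {G : AbelianGroup} (env : list G) a l :
  sum_eval env (sum_insert a l) = plus (signed_eval env a) (sum_eval env l).
Proof.
induction l as [| b l IH]; [reflexivity |]; simpl.
destruct (Nat.eqb_spec (snd a) (snd b)) as [E | _].
- destruct (fst a) eqn:Ea, (fst b) eqn:Eb; simpl; try reflexivity;
    unfold signed_eval; rewrite Ea, Eb, E, plus_assoc.
  + now rewrite plus_opp_r, plus_zero_l.
  + transitivity (plus zero (sum_eval env l)); [symmetry; apply plus_zero_l |].
    f_equal; symmetry; apply plus_opp_l.
- destruct (Nat.ltb (snd a) (snd b)); [reflexivity |]; simpl; rewrite IH.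
  now rewrite !plus_assoc, (plus_comm (signed_eval env a)).
Qed.

Lemma expr_insert_correct {G : AbelianGroup} (env : list G) e : forall sign l,
  sum_eval env (expr_insert sign e l) =
  plus (if sign then expr_eval env e else opp (expr_eval env e)) (sum_eval env l).
Proof.
induction e as [| n | e IH | e1 IH1 e2 IH2]; intros sign l; simpl.
- symmetry; destruct sign; [apply plus_zero_l |].
  etransitivity; [apply f_equal2; [apply opp_zero | reflexivity] | apply plus_zero_l].
- rewrite sum_insert_correct; reflexivity.
- rewrite IH; destruct sign; simpl; rewrite ?opp_opp; reflexivity.
- rewrite IH1, IH2, plus_assoc; destruct sign; rewrite ?opp_plus; reflexivity.
Qed.

Lemma expr_eq {G : AbelianGroup} (env : list G) e1 e2 :
  expr_insert true e1 nil = expr_insert true e2 nil ->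
  expr_eval env e1 = expr_eval env e2.
Proof.
intros E; apply (f_equal (sum_eval env)) in E.
rewrite !expr_insert_correct in E; simpl in E; rewrite !plus_zero_r in E; exact E.
Qed.

Ltac atom_index x env :=
  match env with
  | x :: _ => constr:(O)
  | _ :: ?env' => let n := atom_index x env' in constr:(S n)
  end.

Ltac add_atom x env :=
  match env with
  | _ => let n := atom_index x env in env
  | _ => constr:(x :: env)
  end.

Ltac collect_atoms t env :=
  lazymatch t with
  | zero => env
  | plus ?a ?b => let env := collect_atoms a env in collect_atoms b env
  | minus ?a ?b => let env := collect_atoms a env in collect_atoms b env
  | opp ?a => collect_atoms a env
  | _ => add_atom t env
  end.

Ltac reify_group t env :=
  lazymatch t with
  | zero => constr:(EZero)
  | plus ?a ?b =>
      let a := reify_group a env in let b := reify_group b env in constr:(EPlus a b)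
  | minus ?a ?b =>
      let a := reify_group a env in let b := reify_group b env in
      constr:(EPlus a (EOpp b))
  | opp ?a => let a := reify_group a env in constr:(EOpp a)
  | _ => let n := atom_index t env in constr:(EAtom n)
  end.

Ltac abelian :=
  match goal with
  | |- @eq ?T ?x ?y =>
      let env := collect_atoms x (@nil T) in
      let env := collect_atoms y env in
      let e1 := reify_group x env in
      let e2 := reify_group y env in
      exact (@expr_eq _ env e1 e2 eq_refl)
  end.

(** * Norms and powers of interval lengths *)

Lemma norm_minus_sym {V : NormedModule R_AbsRing} (x y : V) :
  norm (minus x y) = norm (minus y x).
Proof. now rewrite <- (opp_minus y x), norm_opp. Qed.

Lemma norm_minus_diag {V : NormedModule R_AbsRing} (x : V) : norm (minus x x) = 0.
Proof. rewrite minus_eq_zero; exact norm_zero. Qed.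

Lemma norm_triangle_minus {V : NormedModule R_AbsRing} (x y : V) :
  norm (minus x y) <= norm x + norm y.
Proof. unfold minus; rewrite <- (norm_opp y); apply norm_triangle. Qed.

(** The power extended by 0 at 0, unlike [Rpower]: estimates in [hpow] then also
    cover degenerate intervals, and an almost additive germ automatically
    vanishes on them. *)
Definition hpow (beta x : R) : R := if Rle_dec x 0 then 0 else Rpower x beta.

Lemma hpow_pos beta x : 0 < x -> hpow beta x = Rpower x beta.
Proof. intros H; unfold hpow; destruct (Rle_dec x 0); [lra | reflexivity]. Qed.

Lemma hpow_nonpos beta x : x <= 0 -> hpow beta x = 0.
Proof. intros H; unfold hpow; destruct (Rle_dec x 0); [reflexivity | lra]. Qed.

Lemma hpow_ge0 beta x : 0 <= hpow beta x.
Proof.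
unfold hpow; destruct (Rle_dec x 0); [lra |]; unfold Rpower; apply Rlt_le, exp_pos.
Qed.

Lemma hpow_le beta x y : 0 <= beta -> x <= y -> hpow beta x <= hpow beta y.
Proof.
intros Hb Hxy; destruct (Rle_dec x 0) as [Hx | Hx].
- rewrite (hpow_nonpos _ Hx); apply hpow_ge0.
- rewrite !hpow_pos by lra; apply Rle_Rpower_l; lra.
Qed.

Lemma hpow_plus b c x : hpow (b + c) x = hpow b x * hpow c x.
Proof.
unfold hpow; destruct (Rle_dec x 0); [ring |]; apply Rpower_plus.
Qed.

Lemma hpow_1 x : 0 <= x -> hpow 1 x = x.
Proof.
intros Hx; destruct (Rle_lt_or_eq_dec _ _ Hx) as [H | H].
- rewrite hpow_pos by exact H; apply Rpower_1; exact H.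
- rewrite <- H; apply hpow_nonpos; lra.
Qed.

(** The gain that drives the sewing estimate: for theta > 1 the two halves of an
    interval together weigh a factor 2^(1 - theta) < 1 of the whole. *)
Lemma hpow_half theta x :
  2 * hpow theta (x / 2) = Rpower 2 (1 - theta) * hpow theta x.
Proof.
destruct (Rle_dec x 0) as [Hx | Hx].
- rewrite !hpow_nonpos by lra; ring.
- rewrite !hpow_pos by lra.
  replace (Rpower x theta) with (Rpower (2 * (x / 2)) theta) by (f_equal; field).
  rewrite <- Rpower_mult_distr, <- Rmult_assoc, <- Rpower_plus by lra.
  replace (1 - theta + theta) with 1 by ring; rewrite Rpower_1 by lra; ring.
Qed.

Lemma hpow_small beta eps : 0 < beta -> 0 < eps ->
  exists delta, 0 < delta /\ hpow beta delta <= eps.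
Proof.
intros Hb He; exists (Rpower eps (/ beta)); split; [apply exp_pos |].
rewrite hpow_pos by apply exp_pos.
rewrite Rpower_mult, Rinv_l, Rpower_1; lra.
Qed.

(** * Partitions and their Riemann sums *)

(** Partitions as an inductive predicate, for the sake of its induction
    principle. *)
Inductive subdivision : R -> R -> list R -> Prop :=
| subdivision_one s : subdivision s s (s :: nil)
| subdivision_cons s u t l : s < u -> subdivision u t l -> subdivision s t (s :: l).

Lemma subdivision_hd s t l : subdivision s t l -> exists l', l = s :: l'.
Proof. destruct 1; eauto. Qed.

Lemma last_default (x d d' : R) l : last (x :: l) d = last (x :: l) d'.
Proof.
revert x; induction l as [| y l IH]; intros x; [reflexivity | exact (IH y)].
Qed.

Lemma is_partition_subdivision s t l : is_partition s t l <-> subdivision s t l.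
Proof.
split.
- revert s; induction l as [| x l IH]; intros s (H1 & H2 & H3); [discriminate |].
  injection H1 as ->; destruct l as [| u l].
  + simpl in H2; subst t; constructor.
  + destruct H3 as [H3 H4]; apply subdivision_cons with u; [exact H3 |].
    apply IH; repeat split; [| exact H4].
    rewrite (last_default _ _ s); exact H2.
- induction 1 as [s | s u t l Hu Hl (H1 & H2 & H3)]; [repeat split |].
  destruct l as [| x l]; [discriminate |]; injection H1 as ->.
  repeat split; auto.
  rewrite <- H2; exact (last_default u s u l).
Qed.

Lemma partition_sum_cons {E : NormedModule R_AbsRing} (G : R -> R -> E) s u t l :
  subdivision u t l -> partition_sum G (s :: l) = plus (G s u) (partition_sum G l).
Proof. intros H; destruct (subdivision_hd H) as [l' ->]; reflexivity. Qed.

Lemma seq_step_cons s u t l :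
  subdivision u t l -> seq_step (s :: l) = Rmax (Rabs (u - s)) (seq_step l).
Proof. intros H; destruct (subdivision_hd H) as [l' ->]; reflexivity. Qed.

Lemma subdivision_le s t l : subdivision s t l -> s <= t.
Proof. induction 1; lra. Qed.

Lemma subdivision_bounds s t l x : subdivision s t l -> In x l -> s <= x <= t.
Proof.
induction 1 as [s | s u t l Hu Hl IH]; intros [-> | Hx].
- lra.
- destruct Hx.
- apply subdivision_le in Hl; lra.
- apply IH in Hx; lra.
Qed.

Lemma subdivision_exists s t delta : 0 < delta -> s <= t ->
  exists l, subdivision s t l /\ seq_step l <= delta.
Proof.
intros Hd Hst; destruct (nfloor_ex ((t - s) / delta)) as [n [_ Hn]].
{ apply Rcomplements.Rdiv_le_0_compat; lra. }
assert (Hn' : t - s <= INR (S n) * delta).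
{ rewrite S_INR; apply Rlt_le, (Rmult_le_compat_r delta) in Hn; [| lra].
  unfold Rdiv in Hn; rewrite Rmult_assoc, Rinv_l in Hn; lra. }
clear Hn; revert s Hst Hn'; generalize (S n); clear n; intros n.
induction n as [| n IH]; intros s Hst Hn.
- simpl in Hn; replace t with s by lra.
  exists (s :: nil); split; [constructor |]; unfold seq_step; simpl; lra.
- destruct (Rle_dec t (s + delta)) as [H | H].
  + destruct (Rle_lt_or_eq_dec _ _ Hst) as [H' | <-].
    * exists (s :: t :: nil); split; [eauto using subdivision |].
      unfold seq_step; simpl; rewrite Rabs_right by lra.
      apply Rmax_lub; [lra |]; lra.
    * exists (s :: nil); split; [constructor |]; unfold seq_step; simpl; lra.
  + destruct (IH (s + delta)) as [l [Hl Hs]]; [lra | rewrite S_INR in Hn; lra |].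
    exists (s :: l); split; [apply subdivision_cons with (s + delta); [lra | exact Hl] |].
    rewrite (seq_step_cons _ Hl); apply Rmax_lub; [rewrite Rabs_right; lra | exact Hs].
Qed.

(** The interval [[p, q]] that contains [m] is singled out because [m] need not be
    a point of the subdivision; both remaining pieces lie on one side of [m] and
    have strictly fewer points, as an induction on their number requires. *)
Lemma subdivision_split_at_gap {E : NormedModule R_AbsRing} (G : R -> R -> E) m s t l :
  subdivision s t l -> s <= m < t ->
  exists p q l1 l2, subdivision s p l1 /\ subdivision q t l2 /\ p <= m < q /\
    (length l1 < length l)%nat /\ (length l2 < length l)%nat /\
    partition_sum G l = plus (partition_sum G l1) (plus (G p q) (partition_sum G l2)).
Proof.
induction 1 as [s | s u t l Hu Hl IH]; intros Hm; [lra |].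
destruct (Rle_dec u m) as [Hum | Hum].
- destruct IH as (p & q & l1 & l2 & H1 & H2 & H3 & H4 & H5 & H6); [lra |].
  exists p, q, (s :: l1), l2; repeat split; try (simpl; lia); try tauto.
  + apply subdivision_cons with u; auto.
  + rewrite (partition_sum_cons G s Hl), (partition_sum_cons G s H1), H6.
    apply plus_assoc.
- exists s, u, (s :: nil), l; repeat split; try (simpl; lia); try tauto; try lra.
  + constructor.
  + destruct (subdivision_hd Hl) as [l' ->]; simpl; lia.
  + rewrite (partition_sum_cons G s Hl); symmetry; apply plus_zero_l.
Qed.

Lemma subdivision_split_at_point {E : NormedModule R_AbsRing} (G : R -> R -> E) x s t l :
  subdivision s t l -> In x l ->
  exists l1 l2, subdivision s x l1 /\ subdivision x t l2 /\
    (forall y, In y l -> x <= y -> In y l2) /\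
    partition_sum G l = plus (partition_sum G l1) (partition_sum G l2).
Proof.
intros Hl Hx.
destruct (Req_dec s x) as [<- | Hsx].
{ exists (s :: nil), l; repeat split; auto; [constructor |].
  symmetry; apply plus_zero_l. }
revert Hx Hsx; induction Hl as [s | s u t l Hu Hl IH]; intros [Hx | Hx] Hsx;
  try contradiction; try now destruct Hx.
destruct (Req_dec u x) as [<- | Hux].
- exists (s :: u :: nil), l; repeat split; auto.
  + eauto using subdivision.
  + intros y [<- | Hy] Hxy; [lra | exact Hy].
  + rewrite (partition_sum_cons G s Hl); f_equal; symmetry; apply plus_zero_r.
- destruct IH as (l1 & l2 & H1 & H2 & H3 & H4); auto.
  exists (s :: l1), l2; repeat split; auto.
  + apply subdivision_cons with u; auto.
  + intros y [<- | Hy] Hxy; [| auto].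
    apply subdivision_bounds with (x := x) in Hl; [lra | exact Hx].
  + rewrite (partition_sum_cons G s Hl), (partition_sum_cons G s H1), H4.
    apply plus_assoc.
Qed.

Lemma subdivision_insert x s t l : subdivision s t l -> s <= x <= t ->
  exists l', subdivision s t l' /\ incl l l' /\ In x l'.
Proof.
induction 1 as [s | s u t l Hu Hl IH]; intros Hx.
- exists (s :: nil); repeat split; [constructor | apply incl_refl | left; lra].
- destruct (Rle_lt_dec u x) as [Hux | Hux].
  + destruct IH as (l' & H1 & H2 & H3); [lra |].
    exists (s :: l'); repeat split; [now apply subdivision_cons with u | | now right].
    apply incl_cons; [now left | now apply incl_tl].
  + destruct (Req_dec s x) as [<- | Hsx].
    * exists (s :: l); repeat split; [now apply subdivision_cons with u | apply incl_refl | now left].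
    * exists (s :: x :: l); repeat split.
      -- apply subdivision_cons with x; [lra | now apply subdivision_cons with u].
      -- apply incl_cons; [now left | now apply incl_tl, incl_tl, incl_refl].
      -- now right; left.
Qed.

Lemma subdivision_common_refinement s t l1 l2 : subdivision s t l1 -> subdivision s t l2 ->
  exists l, subdivision s t l /\ incl l1 l /\ incl l2 l.
Proof.
intros H1 H2.
assert (Hb : forall x, In x l2 -> s <= x <= t) by (intros x; now apply subdivision_bounds).
clear H2; induction l2 as [| x l2 IH].
- exists l1; repeat split; auto using incl_refl, incl_nil_l.
- destruct IH as (l & Hl & Hl1 & Hl2); [intros; apply Hb; now right |].
  destruct (subdivision_insert (x := x) Hl) as (l' & H' & Hll' & Hx); [apply Hb; now left |].
  exists l'; repeat split; auto.
  + now apply incl_tran with l.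
  + apply incl_cons; [exact Hx | now apply incl_tran with l].
Qed.

(** * Limits along partitions *)

Definition power_sum (theta : R) (l : list R) : R :=
  partition_sum (W := R_NormedModule) (fun u v => hpow theta (v - u)) l.

(** Each interval gives up a factor [(v - u)^(theta - 1)], at most the same power
    of the mesh, and the remaining lengths add up to [t - s]. *)
Lemma power_sum_le theta delta s t l : 1 <= theta ->
  subdivision s t l -> seq_step l <= delta ->
  power_sum theta l <= hpow (theta - 1) delta * (t - s).
Proof.
intros Ht; induction 1 as [s | s u t l Hu Hl IH]; intros Hd.
- unfold power_sum; simpl; unfold zero; simpl; lra.
- rewrite (seq_step_cons _ Hl) in Hd.
  assert (Hd1 := Rle_trans _ _ _ (Rmax_l _ _) Hd).
  assert (Hd2 := Rle_trans _ _ _ (Rmax_r _ _) Hd).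
  rewrite Rabs_right in Hd1 by lra.
  unfold power_sum; rewrite (partition_sum_cons _ s Hl); fold (power_sum theta l).
  change (hpow theta (u - s) + power_sum theta l <= hpow (theta - 1) delta * (t - s)).
  specialize (IH Hd2).
  replace (hpow theta (u - s)) with (hpow (theta - 1) (u - s) * (u - s)).
  + assert (hpow (theta - 1) (u - s) <= hpow (theta - 1) delta) by (apply hpow_le; lra).
    nra.
  + transitivity (hpow (theta - 1) (u - s) * hpow 1 (u - s)).
    * rewrite hpow_1 by lra; reflexivity.
    * rewrite <- hpow_plus; f_equal; ring.
Qed.

Lemma is_partition_lim_eps {E : NormedModule R_AbsRing} (G : R -> R -> E) s t I :
  is_partition_lim G s t I <->
  forall eps, 0 < eps -> exists delta, 0 < delta /\
    forall l, subdivision s t l -> seq_step l < delta -> norm (minus (partition_sum G l) I) < eps.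
Proof.
unfold is_partition_lim.
assert (FF : Filter (partition_filter s t)).
{ apply within_filter, locally_dist_filter. }
split.
- intros H eps He.
  destruct (proj1 (filterlim_locally_ball_norm _ _) H (mkposreal eps He)) as [d Hd].
  exists d; split; [apply cond_pos |]; intros l Hl Hs.
  apply Hd; [exact Hs | now apply is_partition_subdivision].
- intros H; apply filterlim_locally_ball_norm; intros eps.
  destruct (H eps (cond_pos eps)) as [d [Hd0 Hd]].
  exists (mkposreal d Hd0); intros l Hs Hl.
  apply Hd; [now apply is_partition_subdivision | exact Hs].
Qed.

(** Properness is the existence of arbitrarily fine partitions; it makes limits
    along partitions unique, hence selected by [iota]. *)
Lemma partition_filter_proper s t : s <= t -> ProperFilter (partition_filter s t).
Proof.
intros Hst; constructor; [| apply within_filter, locally_dist_filter].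
intros P [d Hd].
assert (Hd2 : 0 < d / 2) by (apply is_pos_div_2).
destruct (subdivision_exists Hd2 Hst) as [l [Hl Hs]].
exists l; apply Hd; [| now apply is_partition_subdivision].
apply Rle_lt_trans with (1 := Hs); assert (H := cond_pos d); lra.
Qed.

(** Germs that differ by O(h^theta) with theta > 1 have the same limits: their
    Riemann sums differ by at most [Rabs K * power_sum theta], which vanishes
    with the mesh. *)
Lemma is_partition_lim_close {E : NormedModule R_AbsRing} (G1 G2 : R -> R -> E)
  theta K s t I : 1 < theta ->
  (forall u v, s <= u -> u < v -> v <= t ->
     norm (minus (G1 u v) (G2 u v)) <= K * hpow theta (v - u)) ->
  is_partition_lim G1 s t I -> is_partition_lim G2 s t I.
Proof.
intros Ht HG; rewrite !is_partition_lim_eps; intros H eps He.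
assert (Hsum : forall l, subdivision s t l ->
  norm (minus (partition_sum G2 l) (partition_sum G1 l)) <= Rabs K * power_sum theta l).
{ clear H; induction 1 as [s | s u t l Hu Hl IH].
  - unfold power_sum; simpl; rewrite norm_minus_diag; unfold zero; simpl; lra.
  - unfold power_sum; rewrite !(partition_sum_cons _ s Hl); fold (power_sum theta l).
    assert (Hut := subdivision_le Hl).
    replace (minus _ _) with
      (plus (minus (G2 s u) (G1 s u)) (minus (partition_sum G2 l) (partition_sum G1 l)))
      by abelian.
    apply Rle_trans with (1 := norm_triangle _ _).
    change (plus (hpow theta (u - s)) (power_sum theta l))
      with (hpow theta (u - s) + power_sum theta l).
    rewrite Rmult_plus_distr_l; apply Rplus_le_compat.
    + rewrite norm_minus_sym; apply Rle_trans with (1 := HG s u (Rle_refl _) Hu Hut).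
      apply Rmult_le_compat_r; [apply hpow_ge0 | apply Rle_abs].
    + apply IH; intros; apply HG; lra. }
destruct (H (eps / 2)) as [d1 [Hd1 H1]]; [lra |].
set (c := Rabs K * (Rabs (t - s)) + 1).
assert (Hc : 0 < c).
{ unfold c; assert (H2 := Rabs_pos K); assert (H3 := Rabs_pos (t - s)); nra. }
destruct (@hpow_small (theta - 1) (eps / 2 / c)) as [d2 [Hd2 H2]]; [lra | |].
{ apply Rdiv_lt_0_compat; lra. }
exists (Rmin d1 d2); split; [now apply Rmin_pos |]; intros l Hl Hs.
assert (Hs1 := Rlt_le_trans _ _ _ Hs (Rmin_l _ _)).
assert (Hs2 := Rlt_le_trans _ _ _ Hs (Rmin_r _ _)).
specialize (H1 l Hl Hs1); specialize (Hsum l Hl).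
assert (Hp : power_sum theta l <= hpow (theta - 1) d2 * (t - s)).
{ apply power_sum_le; lra || assumption. }
rewrite (minus_trans (partition_sum G1 l)).
apply Rle_lt_trans with (1 := norm_triangle _ _).
enough (Rabs K * power_sum theta l <= eps / 2) by lra.
assert (Hst := subdivision_le Hl).
apply Rle_trans with (Rabs K * ((eps / 2 / c) * (t - s))).
- apply Rmult_le_compat_l; [apply Rabs_pos |].
  apply Rle_trans with (1 := Hp), Rmult_le_compat_r; lra.
- replace (eps / 2) with (eps / 2 / c * c) at 2 by (field; lra).
  rewrite <- Rmult_assoc, (Rmult_comm (Rabs K)), Rmult_assoc.
  apply Rmult_le_compat_l.
  + apply Rlt_le, Rdiv_lt_0_compat; lra.
  + unfold c; rewrite (Rabs_right (t - s)) by lra; lra.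
Qed.

(** * The sewing lemma *)

Section Sewing.

Context {E : NormedModule R_AbsRing}.
Variables (G : R -> R -> E) (a b K theta : R).
Hypothesis Htheta : 1 < theta.
Hypothesis HK : 0 <= K.
Hypothesis HG : forall u m v, a <= u -> u <= m -> m <= v -> v <= b ->
  norm (minus (G u v) (plus (G u m) (G m v))) <= K * hpow theta (v - u).

(** The fixed point of [c = c * 2^(1 - theta) + 2]: in the midpoint splitting the
    two halves contribute [c * 2^(1 - theta)], and the two defects 1 each. *)
Definition sewing_const : R := 2 / (1 - Rpower 2 (1 - theta)).

Lemma sewing_const_spec :
  0 <= sewing_const /\ sewing_const * Rpower 2 (1 - theta) + 2 = sewing_const.
Proof.
assert (Rpower 2 (1 - theta) < 1).
{ replace 1 with (Rpower 2 0) at 2 by (apply Rpower_O; lra); apply Rpower_lt; lra. }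
unfold sewing_const; split; [apply Rlt_le, Rdiv_lt_0_compat; lra | field; lra].
Qed.

(** Strong induction on the number of points.  Cut at the interval [[p, q]] that
    contains the midpoint: the outer pieces are at most half as long, so their
    errors add up to a fixed fraction of the whole, and reassembling [s, p], [p, q]
    and [q, t] costs two defects. *)
Lemma partition_sum_bound s t l : subdivision s t l -> a <= s -> t <= b ->
  norm (minus (partition_sum G l) (G s t)) <= sewing_const * K * hpow theta (t - s).
Proof.
destruct sewing_const_spec as [Hc0 Hc].
remember (length l) as n eqn:Hn; revert s t l Hn.
induction n as [n IH] using lt_wf_ind; intros s t l Hn Hl Has Htb.
assert (Hst := subdivision_le Hl).
assert (Hpos := Rmult_le_pos _ _ HK (hpow_ge0 theta (t - s))).
destruct (Rle_lt_or_eq_dec _ _ Hst) as [Hlt | <-].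
- destruct (@subdivision_split_at_gap E G ((s + t) / 2) s t l Hl)
    as (p & q & l1 & l2 & H1 & H2 & Hpq & Hn1 & Hn2 & ->); [lra |].
  assert (Hsp := subdivision_le H1); assert (Hqt := subdivision_le H2).
  assert (Hpb : p <= b) by lra; assert (Haq : a <= q) by lra.
  rewrite <- Hn in Hn1, Hn2.
  assert (B1 := IH _ Hn1 s p l1 eq_refl H1 Has Hpb).
  assert (B2 := IH _ Hn2 q t l2 eq_refl H2 Haq Htb).
  assert (B3 := @HG s q t Has ltac:(lra) Hqt Htb).
  assert (B4 := @HG s p q Has Hsp ltac:(lra) ltac:(lra)).
  replace (minus _ _) with
    (minus (plus (minus (partition_sum G l1) (G s p)) (minus (partition_sum G l2) (G q t)))
           (plus (minus (G s t) (plus (G s q) (G q t)))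
                 (minus (G s q) (plus (G s p) (G p q))))) by abelian.
  apply Rle_trans with (1 := norm_triangle_minus _ _).
  apply Rle_trans with (1 := Rplus_le_compat _ _ _ _ (norm_triangle _ _) (norm_triangle _ _)).
  assert (M1 : hpow theta (p - s) <= hpow theta ((t - s) / 2)) by (apply hpow_le; lra).
  assert (M2 : hpow theta (t - q) <= hpow theta ((t - s) / 2)) by (apply hpow_le; lra).
  assert (M3 : hpow theta (q - s) <= hpow theta (t - s)) by (apply hpow_le; lra).
  assert (Mh := hpow_half theta (t - s)).
  assert (HcK := Rmult_le_pos _ _ Hc0 HK).
  apply (Rmult_le_compat_l _ _ _ HcK) in M1, M2.
  apply (Rmult_le_compat_l _ _ _ HK) in M3.
  apply Rle_trans with
    (sewing_const * K * (2 * hpow theta ((t - s) / 2)) + 2 * (K * hpow theta (t - s)));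
    [lra |].
  rewrite Mh; right.
  transitivity ((sewing_const * Rpower 2 (1 - theta) + 2) * K * hpow theta (t - s));
    [ring | now rewrite Hc].
- inversion Hl as [| s' u t' l' Hu Hl']; subst; [| apply subdivision_le in Hl'; lra].
  (* The defect of the trivial split of [s, s] is the opposite of [G s s]. *)
  assert (B := @HG s s s Has (Rle_refl _) (Rle_refl _) Htb).
  replace (minus (partition_sum G (s :: nil)) (G s s))
    with (minus (G s s) (plus (G s s) (G s s))) by (simpl; abelian).
  rewrite (@hpow_nonpos theta (s - s)) in B |- * by lra; lra.
Qed.

(** On every interval of the coarse subdivision [l], the points of [l'] form a
    subdivision to which [partition_sum_bound] applies. *)
Lemma refinement_bound s t l l' : subdivision s t l -> subdivision s t l' -> incl l l' ->
  a <= s -> t <= b ->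
  norm (minus (partition_sum G l') (partition_sum G l))
    <= sewing_const * K * power_sum theta l.
Proof.
intros Hl; revert l'; induction Hl as [s | s u t l Hu Hl IH]; intros l' Hl' Hincl Has Htb.
- replace l' with (s :: nil).
  + unfold power_sum; simpl; rewrite norm_minus_diag; unfold zero; simpl; lra.
  + inversion Hl' as [| s' u t' l'' Hu Hl'']; [reflexivity | apply subdivision_le in Hl''; lra].
- destruct (subdivision_hd Hl) as [l0 El].
  destruct (@subdivision_split_at_point E G u s t l' Hl') as (l1 & l2 & H1 & H2 & H3 & ->).
  { apply Hincl; right; rewrite El; now left. }
  assert (Hut := subdivision_le Hl).
  unfold power_sum; rewrite !(partition_sum_cons _ s Hl); fold (power_sum theta l).
  replace (minus _ _) with
    (plus (minus (partition_sum G l1) (G s u))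
          (minus (partition_sum G l2) (partition_sum G l))) by abelian.
  apply Rle_trans with (1 := norm_triangle _ _).
  change (plus (hpow theta (u - s)) (power_sum theta l))
    with (hpow theta (u - s) + power_sum theta l).
  rewrite Rmult_plus_distr_l; apply Rplus_le_compat.
  + apply partition_sum_bound; [exact H1 | exact Has | lra].
  + apply IH; [exact H2 | | lra | exact Htb].
    intros y Hy; apply H3; [apply Hincl; now right |].
    apply (subdivision_bounds Hl) in Hy; lra.
Qed.

Lemma partition_sums_close delta s t l1 l2 : a <= s -> t <= b ->
  subdivision s t l1 -> subdivision s t l2 -> seq_step l1 <= delta -> seq_step l2 <= delta ->
  norm (minus (partition_sum G l1) (partition_sum G l2))
    <= 2 * sewing_const * K * (t - s) * hpow (theta - 1) delta.
Proof.
intros Has Htb H1 H2 Hd1 Hd2.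
destruct (subdivision_common_refinement H1 H2) as (l & Hl & Hi1 & Hi2).
assert (B1 := refinement_bound H1 Hl Hi1 Has Htb).
assert (B2 := refinement_bound H2 Hl Hi2 Has Htb).
assert (P1 := power_sum_le (Rlt_le _ _ Htheta) H1 Hd1).
assert (P2 := power_sum_le (Rlt_le _ _ Htheta) H2 Hd2).
destruct sewing_const_spec as [Hc0 _].
assert (HcK := Rmult_le_pos _ _ Hc0 HK).
apply (Rmult_le_compat_l _ _ _ HcK) in P1, P2.
rewrite (minus_trans (partition_sum G l)); apply Rle_trans with (1 := norm_triangle _ _).
rewrite (norm_minus_sym (partition_sum G l1)); lra.
Qed.

Lemma partition_lim_bound s t I : a <= s -> s <= t -> t <= b ->
  is_partition_lim G s t I ->
  norm (minus I (G s t)) <= sewing_const * K * hpow theta (t - s).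
Proof.
intros Has Hst Htb HI; rewrite is_partition_lim_eps in HI.
apply le_epsilon; intros eps He.
destruct (HI eps He) as [d [Hd H]].
assert (Hd2 : 0 < d / 2) by lra.
destruct (subdivision_exists Hd2 Hst) as [l [Hl Hs]].
specialize (H l Hl ltac:(lra)).
assert (B := partition_sum_bound Hl Has Htb).
rewrite (minus_trans (partition_sum G l)); apply Rle_trans with (1 := norm_triangle _ _).
rewrite (norm_minus_sym I); lra.
Qed.

End Sewing.

(** By [partition_sums_close] the Riemann sums satisfy Cauchy's criterion along
    the filter of partitions. *)
Lemma sewing_lim_exists {E : CompleteNormedModule R_AbsRing} (G : R -> R -> E)
  a b K theta : 1 < theta -> 0 <= K -> a <= b ->
  (forall u m v, a <= u -> u <= m -> m <= v -> v <= b ->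
     norm (minus (G u v) (plus (G u m) (G m v))) <= K * hpow theta (v - u)) ->
  exists I, is_partition_lim G a b I.
Proof.
intros Ht HK Hab HG.
assert (FF := partition_filter_proper Hab).
set (Fl := filtermap (partition_sum G) (partition_filter a b)).
exists (lim Fl : E).
apply filterlim_locally.
apply (complete_cauchy Fl); [now apply filtermap_proper_filter |].
intros eps.
(* The added 1 allows dividing by [c] when [K] or [b - a] is zero. *)
set (c := 2 * sewing_const theta * K * (b - a) + 1).
assert (Hc0 : 0 <= sewing_const theta * K * (b - a)).
{ destruct (sewing_const_spec Ht) as [Hc0 _].
  apply Rmult_le_pos; [apply Rmult_le_pos |]; lra. }
assert (Hc : 0 < c) by (unfold c; lra).
assert (He := cond_pos eps).
destruct (@hpow_small (theta - 1) (eps / (2 * c))) as [d [Hd Hde]]; [lra | |].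
{ apply Rdiv_lt_0_compat; lra. }
destruct (subdivision_exists Hd Hab) as [l0 [Hl0 Hs0]].
exists (partition_sum G l0); exists (mkposreal d Hd); intros l Hs Hl.
apply is_partition_subdivision in Hl.
apply (norm_compat1 (V := E)).
apply Rle_lt_trans with (1 := partition_sums_close Ht HK HG (Rle_refl a) (Rle_refl b)
  Hl Hl0 (Rlt_le _ _ Hs) Hs0).
simpl.
apply Rle_lt_trans with (c * (eps / (2 * c))).
- apply Rmult_le_compat; [lra | apply hpow_ge0 | unfold c; lra | exact Hde].
- replace (c * (eps / (2 * c))) with (eps / 2) by (field; lra); lra.
Qed.

(** * Bounded linear and bilinear maps *)

Section LinearMaps.

Context {A B C : NormedModule R_AbsRing}.

Lemma norm_lin_apply (f : Lin A B) x : norm (f x) <= norm f * norm x.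
Proof. exact (op_norm_spec f x). Qed.

Lemma norm_lin_le (f : Lin A B) c :
  0 <= c -> (forall x, norm (f x) <= c * norm x) -> norm f <= c.
Proof. exact (@op_norm_le A B f c). Qed.

Lemma norm_bilin_apply (b : Lin A (Lin B C)) x y :
  norm (b x y) <= norm b * norm x * norm y.
Proof.
apply Rle_trans with (1 := op_norm_spec (b x) y).
apply Rmult_le_compat_r; [apply norm_ge_0 | exact (op_norm_spec b x)].
Qed.

Lemma norm_lin_comp (g : Lin B C) (f : Lin A B) :
  norm (lin_comp g f) <= norm g * norm f.
Proof.
apply op_norm_le.
{ apply Rmult_le_pos; apply (norm_ge_0 (V := Lin _ _)). }
intros x; apply Rle_trans with (1 := op_norm_spec g (f x)).
rewrite Rmult_assoc; apply Rmult_le_compat_l; [apply op_norm_ge0 | apply op_norm_spec].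
Qed.

Lemma lin_eval_at_is_linear (x : A) : is_linear (fun f : Lin A B => f x).
Proof.
split; [reflexivity | reflexivity |].
exists (norm x + 1); assert (Hx := norm_ge_0 x); split; [lra |].
intros f; assert (Hf := norm_ge_0 f); assert (H := norm_lin_apply f x); nra.
Qed.

Definition lin_eval_at (x : A) : Lin (Lin A B) B := MkLin (lin_eval_at_is_linear x).

Lemma lin_eval_is_linear : is_linear lin_eval_at.
Proof.
split.
- intros x y; apply lin_ext; intros f; exact (linear_plus _ (lin_is_linear f) x y).
- intros k x; apply lin_ext; intros f; exact (linear_scal _ (lin_is_linear f) k x).
- exists 1; split; [lra |]; intros x; assert (Hx := norm_ge_0 x).
  apply op_norm_le; [lra |].
  intros f; assert (H := norm_lin_apply f x); simpl.
  change (norm (f x) <= 1 * norm x * norm f); lra.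
Qed.

Definition lin_eval : Lin A (Lin (Lin A B) B) := MkLin lin_eval_is_linear.

End LinearMaps.

Lemma norm_bilin_precomp {A B C D : NormedModule R_AbsRing}
  (p : Lin A (Lin B D)) (q : Lin C B) :
  norm (bilin_precomp p q) <= norm p * norm q.
Proof.
assert (Hp := op_norm_ge0 p); assert (Hq := op_norm_ge0 q).
apply op_norm_le; [now apply Rmult_le_pos |].
intros x; apply Rle_trans with (1 := norm_lin_comp (p x) q : op_norm _ <= _).
assert (H := op_norm_spec p x).
change (op_norm (p x) * op_norm q <= op_norm p * op_norm q * norm x).
change (op_norm (p x) <= op_norm p * norm x) in H.
apply (Rmult_le_compat_r _ _ _ Hq) in H; lra.
Qed.

Lemma bilin_precomp_linear_r {A B C D : NormedModule R_AbsRing}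
  (p : Lin A (Lin B D)) :
  is_linear (fun q : Lin C B => bilin_precomp p q).
Proof.
split.
- intros q r; apply lin_ext; intros a; apply lin_ext; intros c.
  exact (linear_plus _ (lin_is_linear (p a)) (q c) (r c)).
- intros k q; apply lin_ext; intros a; apply lin_ext; intros c.
  exact (linear_scal _ (lin_is_linear (p a)) k (q c)).
- exists (norm p + 1); assert (Hp := norm_ge_0 p); split; [lra |].
  intros q; assert (Hq := norm_ge_0 q).
  apply Rle_trans with (1 := norm_bilin_precomp p q); nra.
Qed.

(** * Uniform boundedness of the universal lift *)

Section TensorLift.

Context {A B : NormedModule R_AbsRing} (AB : tensor_product A B).

(** The lift of [(x, y) |-> (b |-> b x y)], a bounded bilinear map with values in
    the linear forms on bilinear maps.  It treats all bilinear maps [b] at once: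
    [lift_eval C xi b] is the lift of [b] at [xi], so that boundedness of this
    single linear map controls [tens_lift AB b] uniformly in [b]. *)
Definition lift_eval (C : NormedModule R_AbsRing) : Lin AB (Lin (Lin A (Lin B C)) C) :=
  tens_lift AB (lin_comp (MkLin (bilin_precomp_linear_r lin_eval)) lin_eval).

Lemma lift_eval_spec (C : NormedModule R_AbsRing) (b : Lin A (Lin B C)) xi :
  lift_eval C xi b = tens_lift AB b xi.
Proof.
assert (E : lin_comp (lin_eval_at b) (lift_eval C) = tens_lift AB b).
{ apply tens_lift_unique; intros x y.
  change (lift_eval C (tens AB x y) b = tens_lift AB b (tens AB x y)).
  unfold lift_eval; rewrite !tens_lift_tens; reflexivity. }
now rewrite <- E.
Qed.

Lemma norm_tens_lift (C : NormedModule R_AbsRing) (b : Lin A (Lin B C)) xi :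
  norm (tens_lift AB b xi) <= norm (lift_eval C) * norm b * norm xi.
Proof.
rewrite <- lift_eval_spec; apply Rle_trans with (1 := norm_bilin_apply _ xi b); lra.
Qed.

Lemma tens_lift_minus (C : NormedModule R_AbsRing) (b c : Lin A (Lin B C)) xi :
  tens_lift AB (minus b c) xi = minus (tens_lift AB b xi) (tens_lift AB c xi).
Proof.
rewrite <- !lift_eval_spec.
exact (linear_minus _ b c (lin_is_linear (lift_eval C xi))).
Qed.

End TensorLift.

Lemma tens_lift_precomp {U V E : NormedModule R_AbsRing}
  (VV : tensor_product V V) (UU : tensor_product U U)
  (b : Lin U (Lin U E)) (p q : Lin V U) xi :
  tens_lift VV (bilin_precomp (lin_comp b p) q) xi =
  tens_lift UU b (tens_lift VV (bilin_precomp (lin_comp (tens UU) p) q) xi).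
Proof.
assert (H : tens_lift VV (bilin_precomp (lin_comp b p) q) =
  lin_comp (tens_lift UU b) (tens_lift VV (bilin_precomp (lin_comp (tens UU) p) q))).
{ apply tens_lift_unique; intros x y.
  change (tens_lift VV (bilin_precomp (lin_comp b p) q) (tens VV x y) =
    tens_lift UU b
      (tens_lift VV (bilin_precomp (lin_comp (tens UU) p) q) (tens VV x y))).
  rewrite !tens_lift_tens.
  change (b (p x) (q y) = tens_lift UU b (tens UU (p x) (q y))).
  now rewrite tens_lift_tens. }
now rewrite H.
Qed.

(** * Hoelder and controlled paths *)

Lemma two_param_bound_hpow {V : NormedModule R_AbsRing} beta T (G : R -> R -> V) :
  two_param_bound beta T G ->
  exists C, 0 <= C /\ forall s t, 0 <= s -> s < t -> t <= T ->
    norm (G s t) <= C * hpow beta (t - s).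
Proof.
intros [C HC]; exists (Rabs C); split; [apply Rabs_pos |].
intros s t Hs Hst Ht; apply Rle_trans with (1 := HC s t Hs Hst Ht).
rewrite <- hpow_pos by lra.
apply Rmult_le_compat_r; [apply hpow_ge0 | apply Rle_abs].
Qed.

Lemma hpow_two_param_bound {V : NormedModule R_AbsRing} beta T C (G : R -> R -> V) :
  (forall s t, 0 <= s -> s < t -> t <= T -> norm (G s t) <= C * hpow beta (t - s)) ->
  two_param_bound beta T G.
Proof.
intros H; exists C; intros s t Hs Hst Ht; rewrite <- hpow_pos by lra; auto.
Qed.

Lemma holder_bounded {V : NormedModule R_AbsRing} alpha T (X : R -> V) :
  0 <= alpha -> holder alpha T X ->
  exists M, 0 <= M /\ forall t, 0 <= t <= T -> norm (X t) <= M.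
Proof.
intros Ha H; destruct (two_param_bound_hpow H) as [C [HC HX]].
exists (norm (X 0) + C * hpow alpha T); split.
{ assert (H1 := norm_ge_0 (X 0)); assert (H2 := hpow_ge0 alpha T); nra. }
intros t [Ht0 HtT]; destruct (Req_dec t 0) as [-> | Hne].
{ assert (H2 := hpow_ge0 alpha T); nra. }
replace (X t) with (plus (X 0) (incr X 0 t)) by (unfold incr; abelian).
apply Rle_trans with (1 := norm_triangle _ _), Rplus_le_compat_l.
apply Rle_trans with (1 := HX 0 t (Rle_refl 0) ltac:(lra) HtT).
apply Rmult_le_compat_l; [exact HC | apply hpow_le; lra].
Qed.

Lemma controlled_holder {V W : NormedModule R_AbsRing} alpha T (X : R -> V)
  (Y : R -> W) (Y' : R -> Lin V W) :
  0 <= alpha -> holder alpha T X -> controlled alpha T X Y Y' -> holder alpha T Y.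
Proof.
intros Ha HX [HY' HR].
destruct (two_param_bound_hpow HX) as [cX [HcX BX]].
destruct (two_param_bound_hpow HR) as [cR [HcR BR]].
destruct (holder_bounded Ha HY') as [M [HM BM]].
apply hpow_two_param_bound with (M * cX + cR * hpow alpha T); intros s t Hs Hst Ht.
replace (incr Y s t) with
  (plus (Y' s (incr X s t)) (minus (incr Y s t) (Y' s (incr X s t)))) by abelian.
apply Rle_trans with (1 := norm_triangle _ _); rewrite Rmult_plus_distr_r.
apply Rplus_le_compat.
- apply Rle_trans with (1 := norm_lin_apply _ _); rewrite Rmult_assoc.
  apply Rmult_le_compat; try apply norm_ge_0; [apply BM; lra | now apply BX].
- apply Rle_trans with (1 := BR s t Hs Hst Ht).
  replace (2 * alpha) with (alpha + alpha) by ring; rewrite hpow_plus.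
  assert (H0 := hpow_ge0 alpha (t - s)).
  assert (H : hpow alpha (t - s) <= hpow alpha T) by (apply hpow_le; lra).
  rewrite Rmult_assoc; apply Rmult_le_compat_l; [exact HcR |].
  now apply Rmult_le_compat_r.
Qed.

(** * Lipschitz maps and their derivatives *)

(** The mean value inequality, read off from the fundamental theorem of calculus
    along the segment from [x] to [y].  Evaluating at a vector [u] first brings
    the integrand into the complete space [B]; the second derivative is used for
    the continuity of this integrand. *)
Lemma Cb2_lipschitz {A U : NormedModule R_AbsRing} {B : CompleteNormedModule R_AbsRing}
  (F : A -> Lin U B) :
  Cb 2 F -> exists M, 0 <= M /\ forall x y, norm (minus (F y) (F x)) <= M * norm (minus y x).
Proof.
intros (DF & HDF & (M & HM) & (D2F & HD2F & _)).
assert (HM0 : 0 <= M) by (apply Rle_trans with (2 := HM zero), norm_ge_0).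
exists M; split; [exact HM0 |]; intros x y.
set (d := minus y x).
apply norm_lin_le; [apply Rmult_le_pos; [exact HM0 | apply norm_ge_0] |]; intros u.
(* The segment from [x] to [y]. *)
set (c := fun t : R => plus x (scal (t : R_AbsRing) d)).
assert (Hc : forall t, filterdiff c (locally t) (fun h : R => scal (h : R_AbsRing) d)).
{ intros t.
  apply (filterdiff_ext_lin (K := R_AbsRing)) with (l1 := fun h : R => plus zero (scal (h : R_AbsRing) d)).
  - apply filterdiff_plus_fct; [apply filterdiff_const | apply filterdiff_linear].
    apply (is_linear_scal_l (K := R_AbsRing)).
  - intros h; apply plus_zero_l. }
assert (Hcc : forall t, continuous c t).
{ intros t; exact (filterdiff_continuous (K := R_AbsRing) c t (ex_intro _ _ (Hc t))). }
assert (Hint : is_RInt (fun t => DF (c t) d u) 0 1 (minus (F (c 1) u) (F (c 0) u))).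
{ apply (is_RInt_derive (fun t => F (c t) u)).
  - intros t _; unfold is_derive.
    apply (filterdiff_ext_lin (K := R_AbsRing)) with
      (l1 := fun h : R => DF (c t) (scal (h : R_AbsRing) d) u).
    + apply (filterdiff_comp (K := R_AbsRing) (fun t => F (c t)) (fun f : Lin U B => f u)
        (fun h : R => DF (c t) (scal (h : R_AbsRing) d)) (fun f : Lin U B => f u)).
      * apply (filterdiff_comp (K := R_AbsRing) c F (fun h : R => scal (h : R_AbsRing) d) (DF (c t))).
        -- apply Hc.
        -- apply (@filterdiff_locally R_AbsRing A (Lin U B) (filtermap c (locally t))
             (@filtermap_proper_filter _ _ c _ (locally_filter t)) F (c t)); [exact (Hcc t) | apply HDF].
      * apply filterdiff_linear, lin_eval_at_is_linear.
    + intros h.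
      assert (E := linear_scal _ (lin_is_linear (DF (c t))) h d).
      change (DF (c t) (scal h d) = scal h (DF (c t) d)) in E.
      exact (f_equal (fun f : Lin U B => f u) E).
  - intros t _.
    apply (continuous_comp (fun t => DF (c t)) (fun f : Lin A (Lin U B) => f d u)).
    + apply (continuous_comp c DF); [apply Hcc |].
      exact (filterdiff_continuous (K := R_AbsRing) DF (c t) (ex_intro _ _ (HD2F (c t)))).
    + apply (linear_cont (K := R_AbsRing)).
      apply (is_linear_comp (fun f : Lin A (Lin U B) => f d) (fun f : Lin U B => f u));
        apply lin_eval_at_is_linear. }
replace (c 1) with y in Hint.
2: { unfold c, d; rewrite (scal_one (K := R_AbsRing) : forall z, scal 1 z = z); abelian. }
replace (c 0) with x in Hint.
2: { unfold c; rewrite (scal_zero_l (K := R_AbsRing) : forall z, scal 0 z = zero); abelian. }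
change (norm (minus (F y u) (F x u)) <= M * norm d * norm u).
replace (M * norm d * norm u) with ((1 - 0) * (M * norm d * norm u)) by ring.
apply (norm_RInt_le_const (fun t => DF (c t) d u) 0 1); [lra | | exact Hint].
intros t _; apply Rle_trans with (1 := norm_bilin_apply _ _ _).
apply Rmult_le_compat_r; [apply norm_ge_0 |].
apply Rmult_le_compat_r; [apply norm_ge_0 | apply HM].
Qed.

(** A bound valid for every Frechet derivative [Df], which thus need not be
    compared with the derivative that provided the Lipschitz constant. *)
Lemma lipschitz_derivative_bound {A B : NormedModule R_AbsRing}
  (f : A -> B) (Df : A -> Lin A B) M : 0 <= M ->
  (forall x y, norm (minus (f y) (f x)) <= M * norm (minus y x)) ->
  is_frechet_derivative f Df -> forall x, norm (Df x) <= M.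
Proof.
intros HM Hf HDf x; apply norm_lin_le; [exact HM |]; intros w.
apply le_epsilon; intros eps Heps.
assert (Hw := norm_ge_0 w).
assert (He : 0 < eps / (norm w + 1)) by (apply Rdiv_lt_0_compat; lra).
destruct (HDf x) as [_ Hd].
destruct (Hd x (fun P HP => HP) (mkposreal _ He)) as [r Hr]; simpl in Hr.
(* A step towards [w] short enough to stay in the ball of radius [r]; the added
   1 avoids dividing by the norm of a zero vector. *)
set (h := r / 2 / (norm w + 1)).
assert (Hrp := cond_pos r).
assert (Hh : 0 < h) by (unfold h; apply Rdiv_lt_0_compat; lra).
set (y := plus x (scal (h : R_AbsRing) w)).
assert (Ey : minus y x = scal (h : R_AbsRing) w) by (unfold y; abelian).
assert (Hyw : norm (minus y x) <= h * norm w).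
{ rewrite Ey; apply Rle_trans with (1 := norm_scal _ _); unfold abs; simpl.
  rewrite Rabs_right by lra; lra. }
assert (Hball : ball x r y).
{ apply norm_compat1; apply Rle_lt_trans with (1 := Hyw).
  apply Rle_lt_trans with (r / 2); [| lra].
  unfold h; apply Rle_trans with (r / 2 / (norm w + 1) * (norm w + 1)).
  - apply Rmult_le_compat_l; [fold h; lra | lra].
  - right; field; lra. }
specialize (Hr y Hball); specialize (Hf x y).
assert (Hh' : norm (Df x (minus y x)) <= (M + eps / (norm w + 1)) * (h * norm w)).
{ replace (Df x (minus y x)) with
    (minus (minus (f y) (f x)) (minus (minus (f y) (f x)) (Df x (minus y x)))) by abelian.
  apply Rle_trans with (1 := norm_triangle_minus _ _).
  rewrite Rmult_plus_distr_r; apply Rplus_le_compat.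
  - apply Rle_trans with (1 := Hf), Rmult_le_compat_l; assumption.
  - apply Rle_trans with (1 := Hr), Rmult_le_compat_l; [lra | assumption]. }
assert (E : Df x w = scal (/ h : R_AbsRing) (Df x (minus y x))).
{ transitivity (scal (@one R_AbsRing) (Df x w)); [symmetry; apply (scal_one (K := R_AbsRing)) |].
  rewrite Ey, (linear_scal _ (lin_is_linear (Df x)) h w), scal_assoc.
  f_equal; unfold mult, one; simpl; field; lra. }
rewrite E; apply Rle_trans with (1 := norm_scal _ _); unfold abs; simpl.
assert (Hih : 0 < / h) by now apply Rinv_0_lt_compat.
rewrite Rabs_right by lra.
apply Rle_trans with (/ h * ((M + eps / (norm w + 1)) * (h * norm w))).
- apply Rmult_le_compat_l; [lra | exact Hh'].
- replace (/ h * ((M + eps / (norm w + 1)) * (h * norm w)))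
    with (M * norm w + eps / (norm w + 1) * norm w) by (field; lra).
  apply Rplus_le_compat_l.
  apply Rle_trans with (eps / (norm w + 1) * (norm w + 1)).
  + apply Rmult_le_compat_l; lra.
  + right; field; lra.
Qed.

(** * The canonical lift *)

Lemma incr_diag {V : NormedModule R_AbsRing} (X : R -> V) s : incr X s s = zero.
Proof. unfold incr; abelian. Qed.

Lemma norm_zero_eq {V : NormedModule R_AbsRing} (x : V) : x = zero -> norm x = 0.
Proof. intros ->; exact norm_zero. Qed.

Lemma lin_apply_zero {A B : NormedModule R_AbsRing} (f : Lin A B) : f zero = zero.
Proof. exact (linear_zero f (lin_is_linear f)). Qed.

Lemma lin_apply_plus {A B : NormedModule R_AbsRing} (f : Lin A B) x y :
  f (plus x y) = plus (f x) (f y).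
Proof. exact (linear_plus f (lin_is_linear f) x y). Qed.

Lemma lin_apply_minus {A B : NormedModule R_AbsRing} (f : Lin A B) x y :
  f (minus x y) = minus (f x) (f y).
Proof. exact (linear_minus f x y (lin_is_linear f)). Qed.

Lemma rough_path_diag {V : NormedModule R_AbsRing} {VV : tensor_product V V}
  alpha T (X : R -> V) (XX : R -> R -> VV) s :
  rough_path alpha T X XX -> 0 <= s <= T -> XX s s = zero.
Proof.
intros (_ & _ & H) Hs.
specialize (H s s s (proj1 Hs) (Rle_refl s) (Rle_refl s) (proj2 Hs)).
rewrite incr_diag, lin_apply_zero in H.
apply (plus_reg_l (XX s s)); transitivity (XX s s); [| symmetry; apply plus_zero_r].
rewrite H at 3; symmetry; apply plus_zero_r.
Qed.

(** Bounds every increment inside [[a, b]] by the length of the enclosing interval,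
    which turns products of such bounds into powers of one quantity. *)
Lemma two_param_bound_le {V : NormedModule R_AbsRing} beta T (G : R -> R -> V) :
  0 <= beta -> two_param_bound beta T G -> (forall s, 0 <= s <= T -> G s s = zero) ->
  exists C, 0 <= C /\ forall s t a b,
    0 <= a -> a <= s -> s <= t -> t <= b -> b <= T ->
    norm (G s t) <= C * hpow beta (b - a).
Proof.
intros Hb HG HG0; destruct (two_param_bound_hpow HG) as [C [HC BC]].
exists C; split; [exact HC |]; intros s t a b Ha Has Hst Htb HbT.
destruct (Rle_lt_or_eq_dec _ _ Hst) as [Hlt | <-].
- apply Rle_trans with (1 := BC s t ltac:(lra) Hlt ltac:(lra)).
  apply Rmult_le_compat_l; [exact HC | apply hpow_le; lra].
- rewrite norm_zero_eq by (apply HG0; lra).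
  apply Rmult_le_pos; [exact HC | apply hpow_ge0].
Qed.

Section Lift.

Context {U V E : NormedModule R_AbsRing} {VV : tensor_product V V}.
Variables (alpha T : R) (X : R -> V) (XX : R -> R -> VV) (Z : R -> U) (Z' : R -> Lin V U).
Variable tau : Lin U (Lin U E).
Hypothesis Halpha : 0 <= alpha.
Hypothesis HX : rough_path alpha T X XX.
Hypothesis HZ : controlled alpha T X Z Z'.

(** The operator [Z'_r (x) Z'_r], with an arbitrary bounded bilinear map [tau] in
    the place of the tensor product of [U] with itself. *)
Definition second_level (r : R) : Lin VV E :=
  tens_lift VV (bilin_precomp (lin_comp tau (Z' r)) (Z' r)).

(** The germ of the integral of [Z_{s,r} (x) dZ_r], as a function of [u] and [v]
    for a fixed base point [s]. *)
Definition lift_germ (s u v : R) : E :=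
  plus (tau (incr Z s u) (incr Z u v)) (second_level u (XX u v)).

(** The base point [s] cancels out, so that the bound on the defect is uniform in
    it.  Chen's relation produces the term [Z'_u X_{u,m} (x) Z'_u X_{m,v}], which
    compensates [Z_{u,m} (x) Z_{m,v}] up to remainders of [Z]. *)
Lemma lift_germ_defect s u m v : 0 <= u -> u <= m -> m <= v -> v <= T ->
  minus (lift_germ s u v) (plus (lift_germ s u m) (lift_germ s m v)) =
  minus (minus (second_level u (XX m v)) (second_level m (XX m v)))
    (plus (tau (minus (incr Z u m) (Z' u (incr X u m))) (incr Z m v))
          (tau (Z' u (incr X u m)) (minus (incr Z m v) (Z' u (incr X m v))))).
Proof.
intros Hu Hum Hmv Hv; unfold lift_germ.
assert (Esl : second_level u (XX u v) =
  plus (plus (second_level u (XX u m)) (second_level u (XX m v)))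
       (tau (Z' u (incr X u m)) (Z' u (incr X m v)))).
{ destruct HX as (_ & _ & Chen); rewrite (Chen u m v Hu Hum Hmv Hv).
  refine (eq_trans (lin_apply_plus (second_level u) _ _) _).
  f_equal; [exact (lin_apply_plus (second_level u) _ _) |].
  unfold second_level; rewrite tens_lift_tens; reflexivity. }
rewrite Esl.
replace (incr Z u v) with (plus (incr Z u m) (incr Z m v)) by (unfold incr; abelian).
replace (incr Z s m) with (plus (incr Z s u) (incr Z u m)) by (unfold incr; abelian).
rewrite !lin_apply_plus, !lin_apply_minus.
change (lin_fun (plus (tau (incr Z s u)) (tau (incr Z u m))) (incr Z m v))
  with (plus (tau (incr Z s u) (incr Z m v)) (tau (incr Z u m) (incr Z m v))).
change (lin_fun (minus (tau (incr Z u m)) (tau (Z' u (incr X u m)))) (incr Z m v))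
  with (minus (tau (incr Z u m) (incr Z m v)) (tau (Z' u (incr X u m)) (incr Z m v))).
abelian.
Qed.

Lemma second_level_diff u m xi :
  minus (second_level u xi) (second_level m xi) =
  tens_lift VV
    (plus (bilin_precomp (lin_comp tau (Z' u)) (minus (Z' u) (Z' m)))
          (bilin_precomp (lin_comp tau (minus (Z' u) (Z' m))) (Z' m))) xi.
Proof.
unfold second_level; rewrite <- tens_lift_minus; do 2 f_equal.
apply lin_ext; intros x; apply lin_ext; intros y.
change (minus (tau (Z' u x) (Z' u y)) (tau (Z' m x) (Z' m y)) =
  plus (tau (Z' u x) (minus (Z' u y) (Z' m y)))
       (tau (minus (Z' u x) (Z' m x)) (Z' m y))).
rewrite !lin_apply_minus.
change (lin_fun (minus (tau (Z' u x)) (tau (Z' m x))) (Z' m y))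
  with (minus (tau (Z' u x) (Z' m y)) (tau (Z' m x) (Z' m y))).
abelian.
Qed.

Lemma norm_bilin_precomp_comp (p q : Lin V U) :
  norm (bilin_precomp (lin_comp tau p) q) <= norm tau * norm p * norm q.
Proof.
apply Rle_trans with (1 := norm_bilin_precomp _ _).
apply Rmult_le_compat_r; [apply norm_ge_0 | apply norm_lin_comp].
Qed.

(** Every term of [lift_germ_defect] pairs a factor of order [alpha] with one of
    order [2 * alpha]. *)
Lemma lift_germ_almost_additive : exists K, 0 <= K /\
  forall s u m v, 0 <= u -> u <= m -> m <= v -> v <= T ->
    norm (minus (lift_germ s u v) (plus (lift_germ s u m) (lift_germ s m v)))
      <= K * hpow (3 * alpha) (v - u).
Proof.
assert (HZh := controlled_holder Halpha (proj1 HX) HZ).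
assert (Hd : forall s, 0 <= s <= T -> XX s s = zero) by (intros s; exact (rough_path_diag HX)).
destruct HX as (HXh & HXX & _), HZ as (HZ' & HR).
destruct (holder_bounded Halpha HZ') as [M [HM BM]].
destruct (two_param_bound_le Halpha HXh (fun s _ => incr_diag X s)) as [cX [HcX BX]].
destruct (two_param_bound_le Halpha HZh (fun s _ => incr_diag Z s)) as [cZ [HcZ BZ]].
destruct (two_param_bound_le Halpha HZ' (fun s _ => incr_diag Z' s)) as [cZ' [HcZ' BZ']].
assert (H2a : 0 <= 2 * alpha) by lra.
destruct (two_param_bound_le H2a HXX Hd) as [cXX [HcXX BXX]].
destruct (two_param_bound_le H2a HR) as [cR [HcR BR]].
{ intros s _; rewrite !incr_diag, lin_apply_zero; abelian. }
clear HZh HXh HXX HZ' HR Hd.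
set (L := norm (lift_eval VV E)); set (t := norm tau).
assert (HL : 0 <= L) by apply norm_ge_0; assert (Ht : 0 <= t) by apply norm_ge_0.
exists (L * (2 * (t * M * cZ')) * cXX + (t * cR * cZ + t * (M * cX) * (cR + cZ' * cX))).
assert (Hpos : forall x y, 0 <= x -> 0 <= y -> 0 <= x * y) by exact Rmult_le_pos.
split.
{ repeat first [apply Rplus_le_le_0_compat | apply Hpos]; lra. }
intros s u m v Hu Hum Hmv Hv.
assert (HvT : v <= T) by exact Hv.
rewrite (lift_germ_defect s Hu Hum Hmv Hv).
set (H := hpow alpha (v - u)).
assert (HH : 0 <= H) by apply hpow_ge0.
assert (E2 : hpow (2 * alpha) (v - u) = H * H).
{ replace (2 * alpha) with (alpha + alpha) by ring; apply hpow_plus. }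
assert (E3 : hpow (3 * alpha) (v - u) = H * H * H).
{ replace (3 * alpha) with (2 * alpha + alpha) by ring; rewrite hpow_plus, E2; reflexivity. }
assert (Ru := Rle_refl u); assert (Rv := Rle_refl v).
assert (bXum := BX u m u v Hu Ru Hum Hmv Hv).
assert (bXmv := BX m v u v Hu Hum Hmv Rv Hv).
assert (bZmv := BZ m v u v Hu Hum Hmv Rv Hv).
assert (bZ' := BZ' u m u v Hu Ru Hum Hmv Hv).
assert (bXX := BXX m v u v Hu Hum Hmv Rv Hv).
assert (bRum := BR u m u v Hu Ru Hum Hmv Hv).
assert (bRmv := BR m v u v Hu Hum Hmv Rv Hv).
assert (bMu : norm (Z' u) <= M) by (apply BM; lra).
assert (bMm : norm (Z' m) <= M) by (apply BM; lra).
unfold incr in bZ'.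
fold H in bXum, bXmv, bZmv, bZ'; rewrite E2 in bXX, bRum, bRmv.
assert (Hc : forall x a y b, 0 <= x -> 0 <= y -> x <= a -> y <= b -> x * y <= a * b)
  by (intros; now apply Rmult_le_compat).
assert (N := @norm_ge_0 R_AbsRing).
apply Rle_trans with (1 := norm_triangle_minus _ _).
rewrite E3, Rmult_plus_distr_r; apply Rplus_le_compat.
- rewrite second_level_diff.
  apply Rle_trans with (1 := norm_tens_lift _ _); fold L.
  apply Rle_trans with ((L * (2 * (t * M * (cZ' * H)))) * (cXX * (H * H))); [| right; ring].
  apply Hc; [apply Hpos; auto | apply N | | exact bXX].
  apply Rmult_le_compat_l; [exact HL |].
  apply Rle_trans with (1 := norm_triangle _ _).
  replace (2 * (t * M * (cZ' * H))) with (t * M * (cZ' * H) + t * (cZ' * H) * M) by ring.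
  assert (bZ2 : norm (minus (Z' u) (Z' m)) <= cZ' * H) by (rewrite norm_minus_sym; exact bZ').
  apply Rplus_le_compat; apply Rle_trans with (1 := norm_bilin_precomp_comp _ _); fold t.
  + apply Hc; [apply Hpos | | apply Rmult_le_compat_l |]; auto.
  + apply Hc; [apply Hpos | | apply Rmult_le_compat_l |]; auto.
- apply Rle_trans with (1 := norm_triangle _ _).
  rewrite Rmult_plus_distr_r; apply Rplus_le_compat.
  + apply Rle_trans with (1 := norm_bilin_apply _ _ _); fold t.
    apply Rle_trans with (t * (cR * (H * H)) * (cZ * H)); [| right; ring].
    apply Hc; [apply Hpos | | apply Rmult_le_compat_l |]; auto.
  + apply Rle_trans with (1 := norm_bilin_apply _ _ _); fold t.
    apply Rle_trans with (t * (M * (cX * H)) * (cR * (H * H) + cZ' * H * (cX * H)));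
      [| right; ring].
    apply Hc; [apply Hpos; auto | auto | apply Rmult_le_compat_l; [auto |] |].
    * apply Rle_trans with (1 := norm_lin_apply _ _); apply Hc; auto.
    * replace (minus (incr Z m v) (Z' u (incr X m v))) with
        (plus (minus (incr Z m v) (Z' m (incr X m v))) (lin_fun (minus (Z' m) (Z' u)) (incr X m v))).
      2: { change (lin_fun (minus (Z' m) (Z' u)) (incr X m v))
             with (minus (Z' m (incr X m v)) (Z' u (incr X m v))); abelian. }
      apply Rle_trans with (1 := norm_triangle _ _); apply Rplus_le_compat; [exact bRmv |].
      apply Rle_trans with (1 := norm_lin_apply _ _); apply Hc; auto.
Qed.

End Lift.

(** Sewing on [[s, t]] the germ based at [s]; on the whole interval this germ
    reduces to its second-level term since [incr Z s s] is zero. *)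
Lemma canonical_lift_expansion {U V : NormedModule R_AbsRing}
  {VV : tensor_product V V} (UU : tensor_product U U)
  alpha T (X : R -> V) (XX : R -> R -> VV) (Z : R -> U) (Z' : R -> Lin V U) :
  1 / 3 < alpha -> rough_path alpha T X XX -> controlled alpha T X Z Z' ->
  exists C, 0 <= C /\ forall s t, 0 <= s -> s <= t -> t <= T ->
    norm (minus (canonical_lift UU XX Z Z' s t)
      (tens_lift VV (bilin_precomp (lin_comp (tens UU) (Z' s)) (Z' s)) (XX s t)))
    <= C * hpow (3 * alpha) (t - s).
Proof.
intros Ha HX HZ.
assert (Ha0 : 0 <= alpha) by lra; assert (Ha3 : 1 < 3 * alpha) by lra.
destruct (lift_germ_almost_additive (tens UU) Ha0 HX HZ) as [K [HK HG]].
exists (sewing_const (3 * alpha) * K); split.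
{ apply Rmult_le_pos; [apply sewing_const_spec |]; assumption. }
intros s t Hs Hst Ht.
assert (HGs : forall u m v, s <= u -> u <= m -> m <= v -> v <= t ->
  norm (minus (lift_germ XX Z Z' (tens UU) s u v)
    (plus (lift_germ XX Z Z' (tens UU) s u m) (lift_germ XX Z Z' (tens UU) s m v)))
  <= K * hpow (3 * alpha) (v - u)) by (intros; apply HG; lra).
destruct (sewing_lim_exists Ha3 HK Hst HGs) as [I HI].
assert (EI : canonical_lift UU XX Z Z' s t = I).
{ assert (FF := partition_filter_proper Hst).
  apply (iota_filterlim_locally (V := UU)); exact HI. }
rewrite EI.
replace (tens_lift VV _ (XX s t)) with (lift_germ XX Z Z' (tens UU) s s t).
- exact (partition_lim_bound Ha3 HK HGs (Rle_refl s) Hst (Rle_refl t) HI).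
- unfold lift_germ; rewrite incr_diag, lin_apply_zero; apply plus_zero_l.
Qed.

(** * Equivalence of the two equations *)

(** The remainders of [Y] with respect to [X] and to [Z] differ by [G s] applied
    to the remainder of [Z], and [G] is bounded on [[0, T]]. *)
Lemma controlled_transfer {U V W : NormedModule R_AbsRing}
  alpha T (X : R -> V) (Z : R -> U) (Z' : R -> Lin V U)
  (Y : R -> W) (G : R -> Lin U W) (Y' : R -> Lin V W) :
  0 <= alpha -> controlled alpha T X Z Z' -> holder alpha T G ->
  (forall t, 0 <= t <= T -> Y' t = lin_comp (G t) (Z' t)) ->
  (controlled alpha T X Y Y' <-> controlled alpha T Z Y G).
Proof.
intros Ha [HZ' HR] HG HY'.
destruct (holder_bounded Ha HG) as [M [HM BM]].
destruct (two_param_bound_hpow HR) as [cR [HcR BR]].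
assert (Hrem : forall s t, 0 <= s -> s < t -> t <= T ->
  norm (minus (minus (incr Y s t) (Y' s (incr X s t)))
              (minus (incr Y s t) (G s (incr Z s t))))
  <= M * cR * hpow (2 * alpha) (t - s)).
{ intros s t Hs Hst Ht.
  rewrite HY' by lra.
  replace (minus (minus (incr Y s t) (lin_comp (G s) (Z' s) (incr X s t)))
                 (minus (incr Y s t) (G s (incr Z s t))))
    with (G s (minus (incr Z s t) (Z' s (incr X s t)))).
  - apply Rle_trans with (1 := norm_lin_apply _ _); rewrite Rmult_assoc.
    apply Rmult_le_compat; try apply norm_ge_0; [apply BM; lra | now apply BR].
  - rewrite lin_apply_minus.
    change (lin_comp (G s) (Z' s) (incr X s t)) with (G s (Z' s (incr X s t))).
    abelian. }
split; intros [H1 H2]; split.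
- exact HG.
- destruct (two_param_bound_hpow H2) as [c [Hc Bc]].
  apply hpow_two_param_bound with (c + M * cR); intros s t Hs Hst Ht.
  specialize (Bc s t Hs Hst Ht); specialize (Hrem s t Hs Hst Ht).
  replace (minus (incr Y s t) (G s (incr Z s t))) with
    (minus (minus (incr Y s t) (Y' s (incr X s t)))
      (minus (minus (incr Y s t) (Y' s (incr X s t)))
             (minus (incr Y s t) (G s (incr Z s t))))) by abelian.
  apply Rle_trans with (1 := norm_triangle_minus _ _); lra.
- destruct (holder_bounded Ha HZ') as [M' [HM' BM']].
  destruct (two_param_bound_hpow HZ') as [cZ [HcZ BZ]].
  destruct (two_param_bound_hpow HG) as [cG [HcG BG]].
  apply hpow_two_param_bound with (cG * M' + M * cZ); intros s t Hs Hst Ht.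
  specialize (BG s t Hs Hst Ht); specialize (BZ s t Hs Hst Ht).
  replace (incr Y' s t) with
    (plus (lin_comp (incr G s t) (Z' t)) (lin_comp (G s) (incr Z' s t))).
  + apply Rle_trans with (1 := norm_triangle _ _).
    replace ((cG * M' + M * cZ) * hpow alpha (t - s)) with
      (cG * hpow alpha (t - s) * M' + M * (cZ * hpow alpha (t - s))) by ring.
    apply Rplus_le_compat; apply Rle_trans with (1 := norm_lin_comp _ _);
      apply Rmult_le_compat; auto; try apply norm_ge_0; [apply BM' | apply BM]; lra.
  + unfold incr; rewrite !HY' by lra; apply lin_ext; intros x.
    change (plus (minus (G t (Z' t x)) (G s (Z' t x))) (G s (minus (Z' t x) (Z' s x)))
      = minus (G t (Z' t x)) (G s (Z' s x))).
    rewrite lin_apply_minus; abelian.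
- destruct (two_param_bound_hpow H2) as [c [Hc Bc]].
  apply hpow_two_param_bound with (c + M * cR); intros s t Hs Hst Ht.
  specialize (Bc s t Hs Hst Ht); specialize (Hrem s t Hs Hst Ht).
  replace (minus (incr Y s t) (Y' s (incr X s t))) with
    (plus (minus (incr Y s t) (G s (incr Z s t)))
      (minus (minus (incr Y s t) (Y' s (incr X s t)))
             (minus (incr Y s t) (G s (incr Z s t))))) by abelian.
  apply Rle_trans with (1 := norm_triangle _ _); lra.
Qed.

(** By [tens_lift_precomp] the second-order terms of the two germs are the lift of
    [A1 u] at [(Z'_u (x) Z'_u) XX_{u,v}] and at [ZZ_{u,v}], which are close by
    [canonical_lift_expansion]. *)
Lemma controlled_int_iff_rough_int {U V W : NormedModule R_AbsRing}
  {VV : tensor_product V V} (UU : tensor_product U U)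
  alpha T (X : R -> V) (XX : R -> R -> VV) (Z : R -> U) (Z' : R -> Lin V U)
  (A : R -> Lin U W) (A1 : R -> Lin U (Lin U W)) (A' : R -> Lin V (Lin U W)) M s t I :
  1 / 3 < alpha -> rough_path alpha T X XX -> controlled alpha T X Z Z' ->
  0 <= s -> t <= T ->
  (forall r, 0 <= r <= T -> norm (A1 r) <= M) ->
  (forall r, 0 <= r <= T -> A' r = lin_comp (A1 r) (Z' r)) ->
  (is_controlled_int XX A A' Z Z' s t I <->
   is_rough_int Z (canonical_lift UU XX Z Z') A A1 s t I).
Proof.
intros Ha HX HZ Hs Ht HM HA'.
destruct (canonical_lift_expansion UU Ha HX HZ) as [C [HC BC]].
set (L := norm (lift_eval UU W)).
assert (HL : 0 <= L) by apply norm_ge_0.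
assert (Ha3 : 1 < 3 * alpha) by lra.
assert (Hclose : forall u v, s <= u -> u < v -> v <= t ->
  norm (minus (plus (A u (incr Z u v)) (tens_lift UU (A1 u) (canonical_lift UU XX Z Z' u v)))
    (plus (A u (incr Z u v)) (tens_lift VV (bilin_precomp (A' u) (Z' u)) (XX u v))))
  <= L * M * C * hpow (3 * alpha) (v - u)).
{ intros u v Hu Huv Hv.
  assert (B := BC u v ltac:(lra) ltac:(lra) ltac:(lra)).
  rewrite HA', (tens_lift_precomp UU) by lra.
  set (S2 := tens_lift VV (bilin_precomp (lin_comp (tens UU) (Z' u)) (Z' u)) (XX u v)) in *.
  replace (minus (plus (A u (incr Z u v)) (tens_lift UU (A1 u) (canonical_lift UU XX Z Z' u v)))
                 (plus (A u (incr Z u v)) (tens_lift UU (A1 u) S2)))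
    with (tens_lift UU (A1 u) (minus (canonical_lift UU XX Z Z' u v) S2))
    by (refine (eq_trans (lin_apply_minus (tens_lift UU (A1 u)) _ _) _); abelian).
  apply Rle_trans with (1 := norm_tens_lift _ _); fold L.
  replace (L * M * C * hpow (3 * alpha) (v - u))
    with (L * M * (C * hpow (3 * alpha) (v - u))) by ring.
  apply Rmult_le_compat; [| apply norm_ge_0 | | exact B].
  - apply Rmult_le_pos; [exact HL | apply norm_ge_0].
  - apply Rmult_le_compat_l; [exact HL | apply HM; lra]. }
split; intros H.
- apply (is_partition_lim_close (theta := 3 * alpha) (K := L * M * C)) with (3 := H);
    [exact Ha3 |].
  intros u v Hu Huv Hv; rewrite norm_minus_sym; auto.
- apply (is_partition_lim_close (theta := 3 * alpha) (K := L * M * C)) with (3 := H);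
    [exact Ha3 | exact Hclose].
Qed.

Unset Implicit Arguments.

Theorem theorem3p7
  (U V W : CompleteNormedModule R_AbsRing)
  (hU : finite_dim U) (hV : finite_dim V) (hW : finite_dim W)
  (VV : tensor_product V V) (UU : tensor_product U U)
  (alpha T : R) (halpha : 1 / 3 < alpha <= 1 / 2) (hT : 0 < T)
  (X : R -> V) (XX : R -> R -> VV) (hX : rough_path alpha T X XX)
  (Z : R -> U) (Z' : R -> Lin V U) (hZ : controlled alpha T X Z Z')
  (F : W -> Lin U W) (DF : W -> Lin W (Lin U W)) (F0 : W -> W)
  (hF : Cb 2 F) (hDF : is_frechet_derivative F DF) (hF0 : Cb 1 F0)
  (Y : R -> W) (Y' : R -> Lin V W)
  (hY' : forall t, 0 <= t <= T -> Y' t = lin_comp (F (Y t)) (Z' t)) :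
  controlled_rde_solution alpha T X XX Z Z' F DF F0 Y Y'
  <-> rde_solution alpha T Z (canonical_lift UU XX Z Z') F DF F0 Y.
Proof.
assert (Ha : 0 <= alpha) by lra.
destruct (Cb2_lipschitz hF) as [M [HM HFlip]].
assert (HDFM := lipschitz_derivative_bound HM HFlip hDF).
assert (Hint : holder alpha T (fun r => F (Y r)) -> forall t I, 0 <= t <= T ->
  (is_controlled_int XX (fun r => F (Y r)) (fun r => lin_comp (DF (Y r)) (Y' r)) Z Z' 0 t I
   <-> is_rough_int Z (canonical_lift UU XX Z Z')
         (fun r => F (Y r)) (fun r => lin_comp (DF (Y r)) (F (Y r))) 0 t I)).
{ intros HG t I Ht.
  destruct (holder_bounded Ha HG) as [N [HN BN]].
  apply controlled_int_iff_rough_int with (alpha := alpha) (T := T) (X := X) (M := M * N);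
    try assumption; try lra.
  - intros r Hr; apply Rle_trans with (1 := norm_lin_comp _ _).
    apply Rmult_le_compat; try apply norm_ge_0; [apply HDFM | now apply BN].
  (* Associativity of the composition [DF (Y r)], [F (Y r)], [Z' r]. *)
  - intros r Hr; rewrite hY' by exact Hr; now apply lin_ext. }
split.
- intros [HY Hsol].
  assert (HG : holder alpha T (fun r => F (Y r))).
  (* [Y] is Hoelder as a path controlled by [X], and [F] is Lipschitz. *)
  { destruct (two_param_bound_hpow (controlled_holder Ha (proj1 hX) HY)) as [c [Hc Bc]].
    apply hpow_two_param_bound with (M * c); intros s t Hs Hst Ht.
    apply Rle_trans with (1 := HFlip (Y s) (Y t)); rewrite Rmult_assoc.
    apply Rmult_le_compat_l; [exact HM | now apply Bc]. }
  split; [now apply (controlled_transfer Y Ha hZ HG hY') |].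
  intros t Ht; destruct (Hsol t Ht) as [_ (I & J & HI & HJ & E)].
  exists I, J; repeat split; auto; now apply Hint.
- intros [HY Hsol]; assert (HG := proj1 HY).
  split; [now apply (controlled_transfer Y Ha hZ HG hY') |].
  intros t Ht; split; [now apply hY' |].
  destruct (Hsol t Ht) as (I & J & HI & HJ & E).
  exists I, J; repeat split; auto; now apply Hint.
Qed.
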